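(* Let $\mathcal{P}=\langle\Sigma\mid\mathcal{R}\rangle$ be a semigroup presentation and $w\in\Sigma^+$ a base word. Suppose that the Squier complex $S(\mathcal{P},w)$ is finite-dimensional and that the diagram group $D(\mathcal{P},w)$ is finitely generated. If $D(\mathcal{P},w)$ satisfies Property B, then its uniform Hilbert space compression is $1$.
   Context: A semigroup presentation $\mathcal{P}=\langle\Sigma\mid\mathcal{R}\rangle$ consists of an alphabet $\Sigma$ and a set $\mathcal{R}$ of relations $u=v$ with $u,v\in\Sigma^+$. Here $\Sigma^+$ is the free semigroup of non-empty words and $\Sigma^*=\Sigma^+\cup\{1\}$ also contains the empty word $1$. Convention: if $u=v\in\mathcal{R}$ then $v=u\notin\mathcal{R}$ (in particular $u=u\notin\mathcal{R}$). The Squier complex $S(\mathcal{P})$ is the cube complex whose vertices are the words over $\Sigma$; whose oriented edges are $(a,u\to v,b)$ with $a,b\in\Sigma^*$ and $u=v$ or $v=u$ in $\mathcal{R}$, going from $aub$ to $avb$ (and $(a,v\to u,b)$ is the same edge with opposite orientation); and whose $n$-cubes are similarly $(a_1,u_1\to v_1,\dots,a_n,u_n\to v_n,a_{n+1})$, spanned by the vertices $a_1w_1\cdots a_nw_na_{n+1}$ with $w_i\in\{u_i,v_i\}$. $S(\mathcal{P},w)$ is the connected component containing $w$. A semigroup diagram over $\mathcal{P}$ is a finite connected planar graph $\Delta$ (considered up to isotopy) with edges oriented and labelled by $\Sigma$ such that: $\Delta$ has exactly one source vertex $\iota$ and exactly one sink vertex $\tau$; the boundary of each cell (bounded face) has the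 form $pq^{-1}$, where $p$ (top path of the cell) and $q$ (bottom path) are positive paths whose labels satisfy $p=q\in\mathcal{R}$ or $q=p\in\mathcal{R}$; every vertex lies on a positive path from $\iota$ to $\tau$; every positive path is simple. $\Delta$ is bounded by two positive paths from $\iota$ to $\tau$, its top and bottom paths; it is a $(u,v)$-diagram if these are labelled $u$ and $v$. A dipole is a $(u,v)$-cell (top label $u$, bottom label $v$) together with a $(v,u)$-cell such that the top path of the first is the bottom path of the second; it is reduced by removing the common path and identifying the top path of the second cell with the bottom path of the first. A diagram is reduced if it has no dipoles; every diagram has a unique reduced form. The diagram group $D(\mathcal{P},w)$ is the set of reduced $(w,w)$-diagrams with product $\Delta_1\cdot\Delta_2$ = reduced form of the diagram obtained by gluing the bottom path of $\Delta_1$ to the top path of $\Delta_2$. It is naturally isomorphic to $\pi_1(S(\mathcal{P},w),w)$ (each edge of a loop gives a cell). $\#(\Delta)$ denotes the number of cells of $\Delta$. Property B: for a finitely generated $D(\mathcal{P},w)$ with word length $|\cdot|$ with respect to a finite generating set, there exist $C_1,C_2>0$ such that $C_1\cdot\#(\Delta)\leq|\Delta|\leq C_2\cdot\#(\Delta)$ for all $\Delta\in D(\mathcal{P},w)$. The uniform Hilbert space compression of a finitely generated group $G$ with word metric $d$ is the supremum of the $\alpha\in[0,1]$ such that there exist a Hilbert space $\mathcal{H}$, an embedding $f:G\to\mathcal{H}$ and constants $C_1,C_2>0$ with $C_1\cdot d(x,y)^{\alpha}\leq\|f(x)-f(y)\|\leq C_2\cdot d(x,y)$ for all $x,y\in G$.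 *)

(* Defs.v *)
From HB Require Import structures.
From Stdlib Require Import Relation_Operators.
From mathcomp Require Import all_boot all_order all_algebra generic_quotient.
From mathcomp Require Import all_classical all_reals all_analysis.
Import Order.TTheory GRing.Theory Num.Theory.
Import numFieldNormedType.Exports.

Set Implicit Arguments.
Unset Strict Implicit.
Unset Printing Implicit Defensive.

Local Open Scope ring_scope.
Local Open Scope quotient_scope.

Record presentation (Sigma : choiceType) := Presentation {
  relator : seq Sigma -> seq Sigma -> Prop;
  relator_neq1 : forall u v, relator u v -> u <> [::] /\ v <> [::];
  relator_asym : forall u v, relator u v -> ~ relator v u }.

Section Squier.
Variable Sigma : choiceType.
Local Notation word := (seq Sigma).
Variable P : presentation Sigma.

Definition is_cell (u v : word) := relator P u v \/ relator P v u.

(* [Edge a u v b] is the oriented edge (a, u -> v, b). *)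
Record edge := Edge { lctx : word; ctop : word; cbot : word; rctx : word }.

Definition edge_tuple (e : edge) := (lctx e, ctop e, cbot e, rctx e).
Definition tuple_edge (t : word * word * word * word) :=
  let: (a, u, v, b) := t in Edge a u v b.
Lemma edge_tupleK : cancel edge_tuple tuple_edge. Proof. by case. Qed.
HB.instance Definition _ := Choice.copy edge (can_type edge_tupleK).

Definition esrc (e : edge) := lctx e ++ ctop e ++ rctx e.
Definition etgt (e : edge) := lctx e ++ cbot e ++ rctx e.
Definition einv (e : edge) := Edge (lctx e) (cbot e) (ctop e) (rctx e).

Fixpoint is_path (x : word) (s : seq edge) (y : word) : Prop :=
  if s is e :: s' then
    [/\ is_cell (ctop e) (cbot e), esrc e = x & is_path (etgt e) s' y]
  else x = y.

Definition connected_words (x y : word) := exists s, is_path x s y.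

(* ([:: (a_1, (u_1, v_1)); ...; (a_n, (u_n, v_n))], a_(n+1)) stands for the
   n-cube (a_1, u_1 -> v_1, ..., a_n, u_n -> v_n, a_(n+1)). *)
Definition cube := (seq (word * (word * word)) * word)%type.

Definition is_cube (c : cube) :=
  forall t, t \in c.1 -> is_cell t.2.1 t.2.2.

Definition cube_dim (c : cube) := size c.1.

Fixpoint cube_vertices_rec (ts : seq (word * (word * word))) (a : word) :
    seq word :=
  if ts is (a1, (u1, v1)) :: ts' then
    [seq a1 ++ z ++ x | z <- [:: u1; v1], x <- cube_vertices_rec ts' a]
  else [:: a].

Definition cube_vertices (c : cube) := cube_vertices_rec c.1 c.2.

Definition squier_finite_dimensional (w : word) :=
  exists N : nat, forall c : cube, is_cube c ->
    (forall x, x \in cube_vertices c -> connected_words w x) ->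
    (cube_dim c <= N)%N.

(* An (x, y)-diagram is presented by an order in which its cells can be crossed
   when the top path is pushed down to the bottom path, one cell at a time:
   crossing a (u, v)-cell when the current path is labelled [a ++ u ++ b] is the
   edge [Edge a u v b].  Two orders come from the same planar diagram (up to
   isotopy) iff they differ by exchanges of consecutive cells lying side by
   side; see [isotopic]. *)
Definition diagram (x y : word) := {s : seq edge | `[< is_path x s y >]}.

(* #(Delta) *)
Definition ncells x y (D : diagram x y) : nat := size (val D).

Inductive exchange : seq edge -> seq edge -> Prop :=
  Exchange s1 s2 a u1 v1 b u2 v2 c :
    exchange
      (s1 ++ [:: Edge a u1 v1 (b ++ u2 ++ c); Edge (a ++ v1 ++ b) u2 v2 c] ++ s2)
      (s1 ++ [:: Edge (a ++ u1 ++ b) u2 v2 c; Edge a u1 v1 (b ++ v2 ++ c)] ++ s2).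

(* A dipole: up to isotopy, its two cells are crossed consecutively. *)
Inductive dipole_removal : seq edge -> seq edge -> Prop :=
  DipoleRemoval s1 s2 e :
    dipole_removal (s1 ++ [:: e; einv e] ++ s2) (s1 ++ s2).

Definition isotopic x y : diagram x y -> diagram x y -> Prop :=
  clos_refl_sym_trans _ (fun D E => exchange (val D) (val E)).

Definition reduced x y (D : diagram x y) : Prop :=
  forall E F : diagram x y, isotopic D E -> ~ dipole_removal (val E) (val F).

Definition diagram_step x y (D E : diagram x y) : Prop :=
  exchange (val D) (val E) \/ dipole_removal (val D) (val E).

(* Having the same reduced form up to isotopy. *)
Definition diagram_equiv x y : diagram x y -> diagram x y -> Prop :=
  clos_refl_sym_trans _ (@diagram_step x y).

Lemma is_path_cat x s y t z :
  is_path x s y -> is_path y t z -> is_path x (s ++ t) z.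
Proof.
elim: s x => [|e s IHs] x /=; first by move=> ->.
by case=> ? ? /IHs IH /IH.
Qed.

Lemma is_cellC u v : is_cell u v -> is_cell v u.
Proof. by case; [right|left]. Qed.

Lemma einvK : involutive einv. Proof. by case. Qed.

Definition path_inv (s : seq edge) := rev (map einv s).

Lemma is_path_inv x s y : is_path x s y -> is_path y (path_inv s) x.
Proof.
elim: s x => [|e s IHs] x /=; first by move=> ->.
case=> ce <- /IHs; rewrite /path_inv /= rev_cons -cats1 => IH.
by apply: is_path_cat IH _; split=> //=; apply: is_cellC.
Qed.

Definition dnil x : diagram x x :=
  exist _ [::] (introT (asboolP (is_path x [::] x)) (erefl x)).

Definition dcat x y z (D : diagram x y) (E : diagram y z) : diagram x z :=
  exist _ (val D ++ val E) (introT (asboolP _)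
    (is_path_cat (elimT (asboolP _) (valP D)) (elimT (asboolP _) (valP E)))).

Definition dinv x y (D : diagram x y) : diagram y x :=
  exist _ (path_inv (val D))
    (introT (asboolP _) (is_path_inv (elimT (asboolP _) (valP D)))).

Section Equiv.
Variables x y : word.
Definition diagram_eqb (D E : diagram x y) := `[< diagram_equiv D E >].
Lemma diagram_eqb_refl : reflexive diagram_eqb.
Proof. by move=> D; apply/asboolP/rst_refl. Qed.
Lemma diagram_eqb_sym : symmetric diagram_eqb.
Proof. by move=> D E; apply/asboolP/asboolP; apply: rst_sym. Qed.
Lemma diagram_eqb_trans : transitive diagram_eqb.
Proof. by move=> D E F /asboolP ? /asboolP ?; apply/asboolP/(rst_trans _ _ _ D). Qed.
Canonical diagram_equiv_rel :=
  EquivRel diagram_eqb diagram_eqb_refl diagram_eqb_sym diagram_eqb_trans.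
End Equiv.

Lemma dcat_equiv x y z (D D' : diagram x y) (E E' : diagram y z) :
  diagram_equiv D D' -> diagram_equiv E E' ->
  diagram_equiv (dcat D E) (dcat D' E').
Proof.
move=> eD eE; apply: (rst_trans _ _ _ (dcat D' E)).
- elim: eD => {D D' eE} [D D' st|D|D D' _ IH|D D' D'' _ IH1 _ IH2].
  + apply: rst_step; case: st => st; [left|right]; move: st => /= [].
    * by move=> s1 s2 a u1 v1 b u2 v2 c; rewrite -!catA.
    * by move=> s1 s2 e; rewrite -!catA; constructor.
  + exact: rst_refl.
  + exact: rst_sym.
  + exact: rst_trans IH1 IH2.
- elim: eE => {E E' eD} [E E' st|E|E E' _ IH|E E' E'' _ IH1 _ IH2].
  + apply: rst_step; case: st => st; [left|right]; move: st => /= [].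
    * by move=> s1 s2 a u1 v1 b u2 v2 c; rewrite (catA _ s1) (catA _ s1).
    * by move=> s1 s2 e; rewrite (catA _ s1) (catA _ s1); constructor.
  + exact: rst_refl.
  + exact: rst_sym.
  + exact: rst_trans IH1 IH2.
Qed.

Lemma dinv_equiv x y (D E : diagram x y) :
  diagram_equiv D E -> diagram_equiv (dinv D) (dinv E).
Proof.
elim=> {D E} [D E st|D|D E _ IH|D E F _ IH1 _ IH2].
- case: st => st.
  + apply/rst_sym/rst_step; left; rewrite /=.
    case: st => s1 s2 a u1 v1 b u2 v2 c; rewrite /path_inv !map_cat !rev_cat.
    by rewrite -!catA; constructor.
  + apply: rst_step; right; rewrite /=.
    case: st => s1 s2 e; rewrite /path_inv !map_cat !rev_cat -!catA.
    rewrite /= einvK; have := DipoleRemoval (path_inv s2) (path_inv s1) e.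
    by [].
- exact: rst_refl.
- exact: rst_sym.
- exact: rst_trans IH1 IH2.
Qed.

Lemma dinvl x y (D : diagram x y) : diagram_equiv (dcat (dinv D) D) (dnil y).
Proof.
case: D => s ps; have /asboolP := ps; elim: s x ps => [|e s IHs] x ps p.
  by rewrite (_ : dcat _ _ = dnil y); [exact: rst_refl|exact: val_inj].
move: (p) => /= [ce ex /asboolP ps'].
apply: (rst_trans _ _ _ (dcat (dinv (exist _ s ps')) (exist _ s ps'))).
  apply: rst_step; right; rewrite /= /path_inv /= rev_cons -cats1 -catA.
  have := DipoleRemoval (rev (map einv s)) s (einv e).
  by rewrite einvK.
by apply: IHs; apply/asboolP.
Qed.

Variable w : word.

(* As reduced forms are unique, every class contains exactly one reduced
   diagram up to isotopy, and the product of two reduced diagrams is the class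
   of the reduced form of their concatenation. *)
Definition diagram_group := {eq_quot (@diagram_equiv_rel w w)}.

HB.instance Definition _ := Choice.on diagram_group.
HB.instance Definition _ := EqQuotient.on diagram_group.

Definition dclass (D : diagram w w) : diagram_group := \pi_diagram_group D.

Definition dg_one : diagram_group := dclass (dnil w).
Definition dg_mul (g h : diagram_group) : diagram_group :=
  dclass (dcat (repr g) (repr h)).
Definition dg_inv (g : diagram_group) : diagram_group := dclass (dinv (repr g)).

Lemma dclassP (D E : diagram w w) : dclass D = dclass E <-> diagram_equiv D E.
Proof.
split; first by move/eqmodP/asboolP.
by move=> h; apply/eqmodP/asboolP.
Qed.

Lemma dclass_repr g : dclass (repr g) = g. Proof. exact: reprK. Qed.

Lemma repr_dclass D : diagram_equiv (repr (dclass D)) D.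
Proof. by apply/dclassP; rewrite dclass_repr. Qed.

Lemma dclassM D E : dg_mul (dclass D) (dclass E) = dclass (dcat D E).
Proof. by apply/dclassP/dcat_equiv; apply: repr_dclass. Qed.

Lemma dclassV D : dg_inv (dclass D) = dclass (dinv D).
Proof. by apply/dclassP/dinv_equiv/repr_dclass. Qed.

Lemma dg_mulA : associative dg_mul.
Proof.
move=> f g h; rewrite -(dclass_repr f) -(dclass_repr g) -(dclass_repr h).
by rewrite !dclassM; congr dclass; apply: val_inj; rewrite /= catA.
Qed.

Lemma dg_mul1g : left_id dg_one dg_mul.
Proof.
move=> g; rewrite -(dclass_repr g) dclassM.
by congr dclass; apply: val_inj.
Qed.

Lemma dg_mulg1 : right_id dg_one dg_mul.
Proof.
move=> g; rewrite -(dclass_repr g) dclassM.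
by congr dclass; apply: val_inj; rewrite /= cats0.
Qed.

Lemma dg_mulVg : left_inverse dg_one dg_inv dg_mul.
Proof.
move=> g; rewrite -(dclass_repr g) dclassV dclassM.
by apply/dclassP/dinvl.
Qed.

Lemma dg_invK : involutive dg_inv.
Proof.
move=> g; rewrite -(dclass_repr g) !dclassV; congr dclass; apply: val_inj.
by rewrite /= /path_inv map_rev revK -map_comp map_id_in// => e _; exact: einvK.
Qed.

Lemma dg_mulgV : right_inverse dg_one dg_inv dg_mul.
Proof. by move=> g; rewrite -{1}(dg_invK g) dg_mulVg. Qed.

HB.instance Definition _ := isGroup.Build diagram_group
  dg_mulA dg_mul1g dg_mulg1 dg_mulVg dg_mulgV.

End Squier.

Section WordMetric.
Variable G : groupType.

Definition is_word (S : seq G) (s : seq G) :=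
  forall g, g \in s -> g \in S \/ (g^-1)%g \in S.

Definition generating (S : seq G) :=
  forall g, exists2 s, is_word S s & g = (\prod_(h <- s) h)%g.

Definition finitely_generated := exists S : seq G, generating S.

Definition has_word_of_size (S : seq G) (g : G) (n : nat) :=
  exists s, [/\ size s = n, is_word S s & g = (\prod_(h <- s) h)%g].

(* The junk value 0 is only taken outside of the subgroup generated by S. *)
Definition word_length (S : seq G) (g : G) : nat :=
  if pselect (exists n, `[< has_word_of_size S g n >]) is left h
  then ex_minn h else 0%N.

Definition word_dist (S : seq G) (g h : G) : nat := word_length S (g^-1 * h)%g.

End WordMetric.

Record hilbertSpace (R : realType) := HilbertSpace {
  hilbert_sort :> completeNormedModType R;
  inner : hilbert_sort -> hilbert_sort -> R;
  inner_sym : forall x y, inner x y = inner y x;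
  inner_linear : forall (a : R) x y z,
    inner (a *: x + y) z = a * inner x z + inner y z;
  inner_norm : forall x, inner x x = `|x| ^+ 2 }.

(* In MathComp 0 `^ 0 = 1, so that a = 0 is excluded by the case x = y; this
   does not affect the supremum, as [sup set0 = 0]. *)
Definition hilbert_exponents (R : realType) (G : groupType) (S : seq G) : set R :=
  [set a : R | 0 <= a <= 1 /\
    exists (H : hilbertSpace R) (f : G -> H) (C1 C2 : R),
      [/\ 0 < C1, 0 < C2, injective f &
        forall x y, C1 * (word_dist S x y)%:R `^ a <= `|f x - f y|
                       <= C2 * (word_dist S x y)%:R]]%classic.

Definition hilbert_compression (R : realType) (G : groupType) (S : seq G) : R :=
  sup (hilbert_exponents (R := R) S).

Definition property_B (R : realType) (Sigma : choiceType)
    (P : presentation Sigma) (w : seq Sigma) : Prop :=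
  exists2 S : seq (diagram_group P w), generating S &
  exists C1 C2 : R, [/\ 0 < C1, 0 < C2 &
    forall D : diagram P w w, reduced D ->
      C1 * (ncells D)%:R <= (word_length S (dclass D))%:R
                         <= C2 * (ncells D)%:R].

(* Main.v *)
(* Name every edge of a diagram with top path [w] by its history: the cell that
   it is at the bottom of, the edges on top of that cell, and so on up to [w].
   Crossing a cell rewrites the path of named edges, and crossing a cell that
   forms a dipole restores the previous path, so the decorated path only depends
   on the reduced diagram.  The cells occurring in the histories are the
   hyperplanes of Farley's cube complex separating it from the base vertex, and
   the symmetric difference of two such sets of cells is the number of edges of
   a path between the two vertices.

   As in Campbell and Niblo's theorem on finite-dimensional CAT(0) cube
   complexes, a diagram is sent to the vector whose coordinate at a cell [c] is
   [d ^ e], where [d] is the number of cells of the diagram weakly below [c] and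
   [e < 1/2].  Cells with the same [d] are pairwise incomparable, hence span a
   cube, so there are at most [N] of them.  Adding a cell changes each [d] by at
   most 1, so the vector moves by a bounded amount, because the squares of
   [(d+1)^e - d^e <= d^(e-1)] are summable.  Two diagrams differing by [n] cells
   are at distance at least of order [n ^ (1/2 + e)], and Property B turns [n]
   into the word length. *)
From HB Require Import structures.
From Stdlib Require Import Relation_Operators.
Require Import Defs.
From mathcomp Require Import all_boot all_order all_algebra generic_quotient.
From mathcomp Require Import all_classical all_reals all_analysis.
From mathcomp Require Import lra ring zify.
Import Order.TTheory GRing.Theory Num.Theory.
Import numFieldNormedType.Exports.

Set Implicit Arguments.
Unset Strict Implicit.
Unset Printing Implicit Defensive.

Local Open Scope ring_scope.

(** * The Hilbert space of square-summable sequences *)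

Lemma normM_le_sqrD (R : realDomainType) (a b : R) :
  `|a * b| <= a * a + b * b.
Proof.
rewrite ler_norml.
have h1 := sqr_ge0 (a + b); have h2 := sqr_ge0 (a - b).
have h3 := sqr_ge0 a; have h4 := sqr_ge0 b.
by rewrite !expr2 in h1 h2 h3 h4; apply/andP; split; nra.
Qed.

Section SquareSummable.
Local Open Scope classical_set_scope.
Variable R : realType.
Implicit Types f g h : nat -> R.

Definition sq_summable : {pred nat -> R} :=
  [pred f : nat -> R | `[< cvgn (series (fun n => f n * f n)) >]].

Lemma sq_summableP f :
  reflect (cvgn (series (fun n => f n * f n))) (f \in sq_summable).
Proof. exact: asboolP. Qed.

Lemma sq_summable_bounded f M :
  (forall n, series (fun n => f n * f n) n <= M) -> f \in sq_summable.
Proof.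
move=> fM; apply/sq_summableP/nondecreasing_is_cvgn.
  by apply: nondecreasing_series => n _ _; rewrite -expr2 sqr_ge0.
by exists M => _ [n _ <-].
Qed.

Lemma cvg_series_mul f g : f \in sq_summable -> g \in sq_summable ->
  cvgn (series (fun n => f n * g n)).
Proof.
move=> /sq_summableP cf /sq_summableP cg; apply: normed_cvg.
apply: series_le_cvg (is_cvg_seriesD cf cg) => n //=.
- by rewrite addr_ge0// -expr2 sqr_ge0.
- exact: normM_le_sqrD.
Qed.

Lemma sq_summable_submod : GRing.submod_closed sq_summable.
Proof.
split.
  apply: (@sq_summable_bounded _ 0) => n.
  by rewrite /series/= big1// => i _; rewrite mulr0.
move=> a f g fs gs; apply/sq_summableP.
have -> : (fun n => (a *: f + g) n * (a *: f + g) n) =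
    a *: (a *: (fun n => f n * f n)) +
    (2 * a) *: (fun n => f n * g n) + (fun n => g n * g n).
  apply/funext => n; rewrite !fctE /GRing.scale/=; ring.
apply: is_cvg_seriesD; last exact/sq_summableP.
apply: is_cvg_seriesD; apply: is_cvg_seriesZ; last exact: cvg_series_mul.
by apply: is_cvg_seriesZ; exact/sq_summableP.
Qed.

HB.instance Definition _ :=
  GRing.isSubmodClosed.Build _ _ sq_summable sq_summable_submod.

Record l2 := L2 { l2val :> nat -> R; l2P : l2val \in sq_summable }.
HB.instance Definition _ := [isSub for l2val].
HB.instance Definition _ := [Choice of l2 by <:].
HB.instance Definition _ := [SubChoice_isSubLmodule of l2 by <:].

Implicit Types x y z : l2.

Definition l2inner x y : R := limn (series (fun n => x n * y n)).

Lemma l2innerC x y : l2inner x y = l2inner y x.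
Proof.
by rewrite /l2inner; congr (limn (series _)); apply/funext => n; rewrite mulrC.
Qed.

Lemma l2inner_linear a x y z :
  l2inner (a *: x + y) z = a * l2inner x z + l2inner y z.
Proof.
have cxz := cvg_series_mul (l2P x) (l2P z).
have cyz := cvg_series_mul (l2P y) (l2P z).
rewrite /l2inner (_ : (fun n => _) =
    a *: (fun n => x n * z n) + (fun n => y n * z n)).
  by rewrite lim_seriesD//; [rewrite lim_seriesZ|exact: is_cvg_seriesZ].
by apply/funext => n; rewrite !fctE/= mulrDl /GRing.scale/= mulrA.
Qed.

Lemma l2innerDl x y z : l2inner (x + y) z = l2inner x z + l2inner y z.
Proof. by rewrite -[x]scale1r l2inner_linear mul1r scale1r. Qed.

Lemma l2inner0l z : l2inner 0 z = 0.
Proof. by apply: (addrI (l2inner 0 z)); rewrite -l2innerDl !addr0. Qed.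

Lemma l2innerZl a x z : l2inner (a *: x) z = a * l2inner x z.
Proof. by rewrite -[a *: x]addr0 l2inner_linear l2inner0l addr0. Qed.

Lemma sum_sq_le_l2inner x n : \sum_(0 <= i < n) x i * x i <= l2inner x x.
Proof.
have := @nondecreasing_cvgn_le R (series (fun n => x n * x n)) _ _ n.
apply; first by apply: nondecreasing_series => i _ _; rewrite -expr2 sqr_ge0.
exact/sq_summableP/l2P.
Qed.

Lemma l2inner_le x M :
  (forall n, \sum_(0 <= i < n) x i * x i <= M) -> l2inner x x <= M.
Proof.
move=> xM; apply: limr_le; first exact/sq_summableP/l2P.
by apply: nearW => n; exact: xM.
Qed.

Lemma l2inner_ge0 x : 0 <= l2inner x x.
Proof. by have := sum_sq_le_l2inner x 0; rewrite big_geq. Qed.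

Lemma l2inner_eq0 x : l2inner x x = 0 -> x = 0.
Proof.
move=> x0; apply/val_inj/funext => n /=.
have := sum_sq_le_l2inner x n.+1; rewrite x0 big_nat_recr//= => xn.
have s0 : 0 <= \sum_(0 <= i < n) x i * x i.
  by apply: sumr_ge0 => i _; rewrite -expr2 sqr_ge0.
apply/eqP; rewrite -sqrf_eq0 expr2 eq_le.
rewrite -expr2 sqr_ge0 andbT expr2.
by move: xn s0; lra.
Qed.

Lemma l2_cauchy_schwarz x y : l2inner x y ^+ 2 <= l2inner x x * l2inner y y.
Proof.
have [y0|yn0] := eqVneq (l2inner y y) 0.
  by rewrite (l2inner_eq0 y0) l2innerC !l2inner0l expr0n/= mulr0.
have ypos : 0 < l2inner y y by rewrite lt_neqAle eq_sym yn0 l2inner_ge0.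
(* The squared norm of this multiple of the component of [x] orthogonal to [y] is
   [c * (a * c - b ^+ 2)]. *)
have := l2inner_ge0 (l2inner y y *: x + (- l2inner x y) *: y).
rewrite l2inner_linear l2innerZl.
rewrite [l2inner x (_ + _)]l2innerC [l2inner y (_ + _)]l2innerC.
rewrite !l2inner_linear !l2innerZl [l2inner y x]l2innerC.
set a := l2inner x x; set b := l2inner x y; set c := l2inner y y in ypos *.
rewrite (_ : _ + _ = c * (a * c - b ^+ 2)); last by ring.
by rewrite pmulr_rge0// subr_ge0.
Qed.

Definition l2norm x : R := Num.sqrt (l2inner x x).

Lemma l2norm_triangle x y : l2norm (x + y) <= l2norm x + l2norm y.
Proof.
rewrite -ler_sqr ?nnegrE ?addr_ge0 ?sqrtr_ge0// /l2norm sqrrD.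
rewrite !sqr_sqrtr ?l2inner_ge0//.
rewrite l2innerDl [l2inner x (_ + _)]l2innerC [l2inner y (_ + _)]l2innerC.
rewrite !l2innerDl [l2inner y x]l2innerC.
have h : l2inner x y <= Num.sqrt (l2inner x x) * Num.sqrt (l2inner y y).
  rewrite -sqrtrM ?l2inner_ge0//; apply: le_trans (ler_norm _) _.
  by rewrite -sqrtr_sqr ler_wsqrtr// l2_cauchy_schwarz.
by move: h; set p := _ * _; lra.
Qed.

Lemma l2normZ a x : l2norm (a *: x) = `|a| * l2norm x.
Proof.
rewrite /l2norm l2innerZl l2innerC l2innerZl mulrA -expr2.
by rewrite sqrtrM ?sqr_ge0// sqrtr_sqr.
Qed.

Lemma l2norm_eq0 x : l2norm x = 0 -> x = 0.
Proof.
move/eqP; rewrite sqrtr_eq0 => x0; apply: l2inner_eq0.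
by apply/eqP; rewrite eq_le x0 l2inner_ge0.
Qed.

HB.instance Definition _ :=
  Lmodule_isNormed.Build R l2 l2norm_triangle l2normZ l2norm_eq0.

Lemma l2_normE x : `|x| = l2norm x. Proof. by []. Qed.

Lemma l2_sqr_norm x : l2inner x x = `|x| ^+ 2.
Proof. by rewrite l2_normE sqr_sqrtr ?l2inner_ge0. Qed.

Lemma l2_coord_le x n : `|x n| <= `|x|.
Proof.
rewrite -ler_sqr ?nnegrE// -l2_sqr_norm real_normK ?num_real//.
apply: le_trans (sum_sq_le_l2inner x n.+1).
rewrite big_nat_recr//= -expr2 lerDr.
by apply: sumr_ge0 => i _; rewrite -expr2 sqr_ge0.
Qed.

Lemma l2_norm_le x M : 0 <= M ->
  (forall n, \sum_(0 <= i < n) x i * x i <= M ^+ 2) -> `|x| <= M.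
Proof.
by move=> M0 xM; rewrite -ler_sqr ?nnegrE// -l2_sqr_norm; exact: l2inner_le.
Qed.

(* The candidate limit is the coordinatewise one; bounds on partial sums of
   squares pass to it because each involves finitely many coordinates. *)
Lemma l2_complete (F : set_system l2) : ProperFilter F -> cauchy F -> cvg F.
Proof.
move=> FF /cauchyP Fc.
have coord_cvg n : cvg ((fun x : l2 => x n) @ F).
  apply/cauchy_cvgP/cauchyP => e e0; have [x Fx] := Fc e e0.
  exists (x n); suff : F (fun y : l2 => ball (x n) e (y n)) by [].
  apply: filterS Fx => y.
  rewrite -!ball_normE /ball_/=; apply: le_lt_trans.
  exact: (l2_coord_le (x - y)).
pose g n := lim ((fun x : l2 => x n) @ F).
have tailP x e : 0 < e -> F (ball x e) ->
    forall n, \sum_(0 <= i < n) (x i - g i) * (x i - g i) <= e ^+ 2.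
  move=> e0 xe n; apply/ler_addgt0Pr => d d0.
  have : (fun y : l2 => \sum_(0 <= i < n) (x i - y i) * (x i - y i)) @ F -->
      \sum_(0 <= i < n) (x i - g i) * (x i - g i).
    elim: (n) => [|m IHm].
      by under eq_fun do rewrite big_geq//; rewrite big_geq//; exact: cvg_cst.
    under eq_fun do rewrite big_nat_recr//=.
    rewrite big_nat_recr//=; apply: (cvgD IHm).
    by apply: cvgM; apply: cvgB; (exact: cvg_cst || exact: coord_cvg).
  move=> /cvgrPdist_lt/(_ d d0) lim_d.
  (* Some [y] lies both in the ball around [x] and so close to the limit that its partial sum is
     within [d]; then [d] tends to 0. *)
  have [y [/= yd ye]] := filter_ex (filterI lim_d xe).
  move: ye; rewrite -ball_normE /ball_/= => ye.
  have : \sum_(0 <= i < n) (x i - y i) * (x i - y i) <= `|x - y| ^+ 2.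
    by rewrite -l2_sqr_norm; exact: (sum_sq_le_l2inner (x - y) n).
  have : `|x - y| ^+ 2 <= e ^+ 2 by rewrite ler_sqr ?nnegrE// ltW.
  move: yd => /ltr_normlW.
  set p := \sum_(_ <= _ < _) _; set q := \sum_(_ <= _ < _) _.
  by lra.
have [x0 Fx0] := Fc 1 ltr01.
have gs : g \in sq_summable.
  have xg : (fun n => x0 n - g n) \in sq_summable.
    by apply: (@sq_summable_bounded _ (1 ^+ 2)) => n; apply: tailP _ ltr01 Fx0 n.
  have -> : g = l2val x0 - (fun n => x0 n - g n).
    by apply/funext => n; rewrite !fctE/= opprB addrC subrK.
  by apply: rpredB => //; exact: l2P.
apply/cvg_ex; exists (L2 gs); apply/cvgrPdist_le => e e0.
have e20 : 0 < e / 2 by rewrite divr_gt0.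
have [x Fx] := Fc _ e20; apply: filterS (Fx) => y.
rewrite -ball_normE /ball_/= => xy; rewrite -[X in X - y](subrK x) -addrA.
apply: le_trans (ler_normD _ _) _; rewrite [e]splitr; apply: lerD; last exact: ltW.
rewrite distrC; apply: l2_norm_le; first exact: ltW.
exact: tailP x (e / 2) e20 Fx.
Qed.

HB.instance Definition _ := Uniform_isComplete.Build l2 l2_complete.

Definition l2_hilbert : hilbertSpace R :=
  HilbertSpace l2innerC l2inner_linear l2_sqr_norm.

End SquareSummable.

(** * Decorated words *)

Lemma cat_eq_prefix (T : Type) (A B C D : seq T) :
  A ++ B = C ++ D -> (size A <= size C)%N ->
  exists2 M, C = A ++ M & B = M ++ D.
Proof.
elim: A C => [|a A IHA] [|c C] //=; first by move=> ->; exists [::].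
  by move=> eB _; exists (c :: C).
by case=> -> eAC /(IHA C eAC)[M -> ->]; exists M.
Qed.

(** Overlapping occurrences would share a letter: the first letter of whichever factor starts later.
    The auxiliary claim treats the case where [U] starts no later than [V]. *)
Lemma disjoint_factors (T : eqType) (A U B C V D : seq T) :
  A ++ U ++ B = C ++ V ++ D -> U != [::] -> V != [::] -> ~~ has (mem U) V ->
  (exists2 M, A = C ++ V ++ M & D = M ++ U ++ B) \/
  (exists2 M, C = A ++ U ++ M & B = M ++ V ++ D).
Proof.
have aux (A1 U1 B1 C1 V1 D1 : seq T) :
    A1 ++ U1 ++ B1 = C1 ++ V1 ++ D1 -> V1 != [::] -> ~~ has (mem U1) V1 ->
    (size A1 <= size C1)%N ->
    exists2 M, C1 = A1 ++ U1 ++ M & B1 = M ++ V1 ++ D1.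
  move=> eq V0 UV le_AC; have [M eC eq'] := cat_eq_prefix eq le_AC.
  have [le_UM|lt_MU] := leqP (size U1) (size M).
    have [N eM eB] := cat_eq_prefix eq' le_UM.
    by exists N; rewrite // eC eM.
  have [[|x N] eU eV] := cat_eq_prefix (esym eq') (ltnW lt_MU).
    by move: lt_MU; rewrite eU cats0 ltnn.
  case: V1 => [|y V1] // in V0 UV eV eq eq' *; case: eV => eyx _.
  by move: UV; rewrite /= eU eyx mem_cat mem_head orbT.
move=> eq U0 V0 UV; have [le_AC|/ltnW le_CA] := leqP (size A) (size C).
  by right; exact: aux.
left; apply: aux => //; apply: contra UV => /hasP[x xU xV].
by apply/hasP; exists x.
Qed.

(** A second occurrence would repeat the first letter of [U]. This locates the top or bottom path of
    a cell in a path of named edges. *)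
Lemma uniq_factor (T : eqType) (A U B C D : seq T) :
  uniq (A ++ U ++ B) -> U != [::] -> A ++ U ++ B = C ++ U ++ D ->
  A = C /\ B = D.
Proof.
case: U => [|x U] // + _; elim: A C => [|a A IHA] [|c C] //=.
- by move=> _ [/(congr1 (drop (size U)))]; rewrite !drop_size_cat.
- move=> /andP[xUB _] [exc eU]; move: xUB.
  by rewrite eU mem_cat in_cons eqxx !orbT.
- by case/andP=> + _ [ea _]; rewrite ea mem_cat in_cons eqxx orbT.
- by case/andP=> _ uA [-> /(IHA _ uA)[-> ->]].
Qed.

Lemma mem_nonempty (T : eqType) (s : seq T) : s != [::] -> exists l, l \in s.
Proof. by case: s => // x s _; exists x; rewrite mem_head. Qed.

Lemma mem_perm_cons (T : eqType) (c : T) (s s' : seq T) :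
  uniq s -> perm_eq s (c :: s') ->
  forall x : T, (x \in s') = (x != c) && (x \in s).
Proof.
move=> us sP x; rewrite (perm_mem sP) in_cons; case: eqVneq => [->|]//=.
by apply/negbTE; move: us; rewrite (perm_uniq sP) => /andP[].
Qed.

Lemma exists_max (T : eqType) (f : T -> nat) (s : seq T) : s != [::] ->
  exists2 c, c \in s & forall d, d \in s -> (f d <= f c)%N.
Proof.
elim: s => // x [|y s] IHs _.
  by exists x; rewrite ?mem_head// => d; rewrite inE => /eqP->.
have [//|c cs cmax] := IHs.
have [le_xc|/ltnW le_cx] := leqP (f x) (f c).
  exists c; first by rewrite in_cons cs orbT.
  by move=> d; rewrite in_cons => /orP[/eqP->//|]; exact: cmax.
exists x; rewrite ?mem_head// => d; rewrite in_cons => /orP[/eqP->//|/cmax].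
by move=> h; apply: leq_trans h le_cx.
Qed.

Lemma count_lt (T : eqType) (a b : pred T) (s : seq T) (x : T) :
  subpred a b -> x \in s -> b x -> ~~ a x -> (count a s < count b s)%N.
Proof.
move=> ab + bx nax; elim: s => //= y s IHs; rewrite in_cons => /orP[/eqP<-|/IHs lt].
  by rewrite bx (negbTE nax) add0n add1n ltnS sub_count.
by rewrite -addnS leq_add//; case: (a y) (ab y) => // ->.
Qed.

Section DecoratedWords.
Variable Sigma : choiceType.
Local Notation word := (seq Sigma).

(* An edge of a reduced diagram with top path [w], named by its history:
   [Leaf i x] is the [i]-th edge of the top path and [Node U v i x] the [i]-th
   edge of the bottom path, labelled [v], of the cell whose top path is [U]. *)
Inductive letter :=
  Leaf of nat & Sigma | Node of seq letter & word & nat & Sigma.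

HB.instance Definition _ := gen_eqMixin letter.
HB.instance Definition _ := gen_choiceMixin letter.

Definition label l := match l with Leaf _ x => x | Node _ _ _ x => x end.
Definition labels (q : seq letter) : word := map label q.

(** The top path is a path of named edges, while the bottom path is a bare word: its edges receive
    their names from the cell itself, through [bot]. *)
Definition cell := (seq letter * word)%type.

Definition bot (c : cell) : seq letter :=
  [seq Node c.1 c.2 p.1 p.2 | p <- zip (iota 0 (size c.2)) c.2].

Definition leaves (w : word) : seq letter :=
  [seq Leaf p.1 p.2 | p <- zip (iota 0 (size w)) w].

Lemma labels_cat q r : labels (q ++ r) = labels q ++ labels r.
Proof. exact: map_cat. Qed.

Lemma labels_bot c : labels (bot c) = c.2.
Proof. by rewrite /labels -map_comp -/unzip2 unzip2_zip ?size_iota. Qed.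

Lemma labels_leaves w : labels (leaves w) = w.
Proof. by rewrite /labels -map_comp -/unzip2 unzip2_zip ?size_iota. Qed.

Lemma size_bot c : size (bot c) = size c.2.
Proof. by rewrite -(size_map (@label)) -/(labels _) labels_bot. Qed.

Lemma bot_eq0 c : (bot c == [::]) = (c.2 == [::]).
Proof. by rewrite -!size_eq0 size_bot. Qed.

Lemma uniq_zip_iota (v : word) : uniq (zip (iota 0 (size v)) v).
Proof.
by apply: (@map_uniq _ _ fst); rewrite -/unzip1 unzip1_zip ?size_iota// iota_uniq.
Qed.

Lemma uniq_bot c : uniq (bot c).
Proof. by rewrite map_inj_uniq ?uniq_zip_iota// => -[? ?] [? ?] [-> ->]. Qed.

Lemma uniq_leaves w : uniq (leaves w).
Proof. by rewrite map_inj_uniq ?uniq_zip_iota// => -[? ?] [? ?] [-> ->]. Qed.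

Lemma mem_bot c l : l \in bot c -> exists j x, l = Node c.1 c.2 j x.
Proof. by case/mapP=> -[j x] _ ->; exists j, x. Qed.

(** A name records the cell that the edge is at the bottom of. *)
Lemma mem_bot_inj c c' l : l \in bot c -> l \in bot c' -> c = c'.
Proof.
move=> /mem_bot[j [x ->]] /mem_bot[j' [x' [e1 e2 _ _]]].
by rewrite (surjective_pairing c) e1 e2 -surjective_pairing.
Qed.

Lemma bot_notin_leaves c w l : l \in bot c -> l \notin leaves w.
Proof.
by move=> /mem_bot[j [x ->]]; apply/negP => /mapP[].
Qed.

(** A rank on histories. It grows strictly from a cell to the cells below it, so it serves for
    induction and for choosing lowest cells. *)
Fixpoint lsize l :=
  match l with Leaf _ _ => 0%N | Node U _ _ _ => (sumn (map lsize U)).+1 end.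
Definition csize (c : cell) := sumn (map lsize c.1).

Lemma lsize_le_csize l c : l \in c.1 -> (lsize l <= csize c)%N.
Proof.
rewrite /csize; elim: c.1 => //= a U IHU; rewrite in_cons => /orP[/eqP->|/IHU].
  by rewrite leq_addr.
by move=> h; apply: leq_trans h (leq_addl _ _).
Qed.

Lemma csize_lt c c' l : l \in bot c -> l \in c'.1 -> (csize c < csize c')%N.
Proof. by move=> /mem_bot[j [x ->]] /lsize_le_csize. Qed.

Fixpoint anc l : seq cell :=
  match l with
  | Leaf _ _ => [::]
  | Node U v _ _ => (U, v) :: flatten (map anc U)
  end.

(** The order on cells: [c \in canc c'] means that [c] lies weakly above [c']. *)
Definition canc (c : cell) : seq cell := c :: flatten (map anc c.1).
Definition cells (q : seq letter) : seq cell := undup (flatten (map anc q)).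

Lemma anc_bot c l : l \in bot c -> anc l = canc c.
Proof. by move=> /mem_bot[j [x ->]] /=; rewrite /canc; case: c. Qed.

(** The order is generated by the parent relation: the ancestors of a [Node] on the top path of a
    cell are those of the cell that it names, whose rank is smaller. *)
Lemma canc_ind (Q : cell -> cell -> Prop) :
  (forall c, Q c c) ->
  (forall c c1 c2 l, l \in c2.1 -> anc l = canc c1 -> c \in canc c1 ->
     (csize c1 < csize c2)%N -> Q c c1 -> Q c c2) ->
  forall c c', c \in canc c' -> Q c c'.
Proof.
move=> Qrefl Qstep c c'; have [n] := ubnP (csize c').
elim: n c' => // n IHn c' le_n; rewrite in_cons => /orP[/eqP->//|].
case/flattenP=> _ /mapP[l lc' ->]; case: l lc' => // U v j x lc' cl.
have lt : (csize (U, v) < csize c')%N by exact: lsize_le_csize lc'.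
apply: (Qstep c (U, v) c' _ lc') => //.
by apply: IHn => //; apply: leq_trans lt _.
Qed.

Lemma canc_refl c : c \in canc c. Proof. exact: mem_head. Qed.

Lemma canc_trans c c' c'' :
  c \in canc c' -> c' \in canc c'' -> c \in canc c''.
Proof.
move=> + c'c''; move: c' c'' c'c''; apply: canc_ind => //.
move=> c' c1 c2 l lc2 al _ _ IH /IH cc1; rewrite in_cons; apply/orP; right.
by apply/flattenP; exists (anc l); [exact: map_f | rewrite al].
Qed.

Lemma canc_csize c c' : c \in canc c' -> c = c' \/ (csize c < csize c')%N.
Proof.
move: c c'; apply: canc_ind => [c|c c1 c2 l _ _ _ lt IH]; first by left.
by right; case: IH => [->//|lt']; apply: ltn_trans lt' lt.
Qed.

Lemma canc_antisym c c' : c \in canc c' -> c' \in canc c -> c = c'.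
Proof.
move=> /canc_csize[//|lt] /canc_csize[//|lt'].
by have := ltn_trans lt lt'; rewrite ltnn.
Qed.

Lemma canc_parent c c' l : l \in bot c -> l \in c'.1 -> c \in canc c'.
Proof.
move=> lc lc'; rewrite in_cons; apply/orP; right.
by apply/flattenP; exists (anc l); [exact: map_f | rewrite (anc_bot lc) canc_refl].
Qed.

Lemma mem_cells c q : (c \in cells q) = has (fun l => c \in anc l) q.
Proof.
rewrite mem_undup; apply/flattenP/hasP => [[_ /mapP[l lq ->] cl]|[l lq cl]].
  by exists l.
by exists (anc l) => //; exact: map_f.
Qed.

(* [dipole_top U] is the top path of a cell that a cell with top path [U] could
   cancel; the value is junk when [U] is not the bottom path of a cell. *)
Definition dipole_top (U : seq letter) : seq letter :=
  if U is Node V _ _ _ :: _ then V else [::].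

(** The top path of [c] is the whole bottom path of a cell whose top label is [c.2]: the two form a
    dipole. *)
Definition cancels (c : cell) : bool :=
  (c.1 == bot (dipole_top c.1, labels c.1)) && (labels (dipole_top c.1) == c.2).

Definition flip (c : cell) : seq letter :=
  if cancels c then dipole_top c.1 else bot c.

Lemma labels_flip c : labels (flip c) = c.2.
Proof.
by rewrite /flip; case: ifP => [/andP[_ /eqP]|_]; last exact: labels_bot.
Qed.

Lemma dipole_top_bot c : c.2 != [::] -> dipole_top (bot c) = c.1.
Proof. by case: c => U [|x v]. Qed.

Lemma cancels_bot c : c.2 != [::] -> cancels (bot c, labels c.1).
Proof.
move=> c2; rewrite /cancels/= dipole_top_bot// labels_bot.
by rewrite -surjective_pairing !eqxx.
Qed.

Lemma flip_bot c : c.2 != [::] -> flip (bot c, labels c.1) = c.1.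
Proof. by move=> c2; rewrite /flip cancels_bot//= dipole_top_bot. Qed.

(** The factor to rewrite is located by lengths alone, which makes [act] total; it models the
    crossing of [e] when [labels q] is [esrc e]. *)
Definition act (q : seq letter) (e : edge Sigma) : seq letter :=
  let r := drop (size (lctx e)) q in
  take (size (lctx e)) q ++ flip (take (size (ctop e)) r, cbot e) ++
  drop (size (ctop e)) r.

Lemma act_cat A U B a u v b : size A = size a -> size U = size u ->
  act (A ++ U ++ B) (Edge a u v b) = A ++ flip (U, v) ++ B.
Proof.
by move=> sA sU; rewrite /act/= -sA -sU !(take_size_cat, drop_size_cat).
Qed.

Lemma labels_catP q a u b : labels q = a ++ u ++ b ->
  exists A U B, [/\ q = A ++ U ++ B, labels A = a, labels U = u & labels B = b].
Proof.
move=> qE; exists (take (size a) q), (take (size u) (drop (size a) q)),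
  (drop (size u) (drop (size a) q)).
by rewrite !cat_take_drop /labels !(map_take, map_drop) -/(labels q) qE
  !(take_size_cat, drop_size_cat).
Qed.

Definition cell_edge A (c : cell) B : edge Sigma :=
  Edge (labels A) (labels c.1) c.2 (labels B).

Lemma act_cell_edge A c B :
  act (A ++ c.1 ++ B) (cell_edge A c B) = A ++ flip c ++ B.
Proof. by rewrite act_cat ?size_map//; case: c. Qed.

End DecoratedWords.

(** * Diagrams and their sets of cells *)

Section Reachable.
Variables (Sigma : choiceType) (P : presentation Sigma).
Local Notation word := (seq Sigma).
Local Notation cell := (cell Sigma).
Implicit Types (s t : seq (edge Sigma)) (e : edge Sigma) (x y z : word).

(** [diagram_equiv] on bare edge sequences, so that endpoints can be rewritten without casts between
    types of diagrams. *)
Definition dequiv x y s t :=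
  exists D E : diagram P x y, [/\ val D = s, val E = t & diagram_equiv D E].

Definition mkdiagram x y s (p : is_path P x s y) : diagram P x y :=
  exist _ s (introT (asboolP _) p).

Lemma diagram_path x y (D : diagram P x y) : is_path P x (val D) y.
Proof. exact/asboolP/(valP D). Qed.

Lemma dequiv_path x y s t : dequiv x y s t ->
  is_path P x s y /\ is_path P x t y.
Proof. by case=> D [E [<- <- _]]; split; apply: diagram_path. Qed.

Lemma dequivP x y (D E : diagram P x y) :
  dequiv x y (val D) (val E) <-> diagram_equiv D E.
Proof.
split=> [[D' [E' [/val_inj-> /val_inj->]]]//|DE].
by exists D, E.
Qed.

Lemma dequiv_refl x y s : is_path P x s y -> dequiv x y s s.
Proof.
by move=> ps; exists (mkdiagram ps), (mkdiagram ps); split=> //; apply: rst_refl.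
Qed.

Lemma dequiv_sym x y s t : dequiv x y s t -> dequiv x y t s.
Proof. by case=> D [E [<- <- DE]]; apply/dequivP/rst_sym. Qed.

Lemma dequiv_trans x y s t r :
  dequiv x y s t -> dequiv x y t r -> dequiv x y s r.
Proof.
move=> [D [E [<- <- DE]]] [E' [F [/val_inj eE <- EF]]]; rewrite {}eE in EF.
exact/dequivP/(rst_trans _ _ _ E).
Qed.

Lemma dequiv_cat x y z s s' t t' :
  dequiv x y s s' -> dequiv y z t t' -> dequiv x z (s ++ t) (s' ++ t').
Proof.
move=> [D [D' [<- <- DD']]] [E [E' [<- <- EE']]].
have := dcat_equiv DD' EE'; set F := dcat D E; set F' := dcat D' E'.
by move=> /dequivP.
Qed.

Lemma dequiv_exchange x y s t : exchange s t ->
  is_path P x s y -> is_path P x t y -> dequiv x y s t.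
Proof.
by move=> st ps pt; exists (mkdiagram ps), (mkdiagram pt); split=> //;
   apply: rst_step; left.
Qed.

Lemma dequiv_dipole x y s t : dipole_removal s t ->
  is_path P x s y -> is_path P x t y -> dequiv x y s t.
Proof.
by move=> st ps pt; exists (mkdiagram ps), (mkdiagram pt); split=> //;
   apply: rst_step; right.
Qed.

Lemma is_path_catE x s t z : is_path P x (s ++ t) z <->
  exists2 y, is_path P x s y & is_path P y t z.
Proof.
split=> [|[y ps pt]]; last exact: is_path_cat ps pt.
elim: s x => [|e s IHs] x /=; first by exists x.
by case=> ce ex /IHs[y ps pt]; exists y.
Qed.

Lemma is_path_rcons x s e z : is_path P x (rcons s e) z <->
  [/\ is_path P x s (esrc e), is_cell P (ctop e) (cbot e) & etgt e = z].
Proof.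
rewrite -cats1; split=> [/is_path_catE[y ps [ce ey ez]]|[ps ce ez]].
  by rewrite ey.
by apply/is_path_catE; exists (esrc e).
Qed.

Lemma is_cell_neq0 (u v : word) : is_cell P u v -> u != [::] /\ v != [::].
Proof. by case=> /relator_neq1[? ?]; split; apply/eqP. Qed.

Variable w : word.

(* [built t q cs]: the path [t] only adds cells, the latest one being the first
   of [cs], and ends in the decorated word [q]. *)
Inductive built : seq (edge Sigma) -> seq (letter Sigma) -> seq cell -> Prop :=
| built_nil : built [::] (leaves w) [::]
| built_rcons t A c B cs : built t (A ++ c.1 ++ B) cs ->
    is_cell P (labels c.1) c.2 -> ~~ cancels c ->
    built (rcons t (cell_edge A c B)) (A ++ bot c ++ B) (c :: cs).

Lemma built_path t q cs : built t q cs -> is_path P w t (labels q).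
Proof.
elim=> [|{t q cs} t A c B cs _ IH cc _]; first by rewrite /= labels_leaves.
apply/is_path_rcons; split=> //.
  by rewrite /esrc /= -!labels_cat.
by rewrite /etgt /= !labels_cat labels_bot.
Qed.

Lemma built_acts t q cs : built t q cs -> foldl (@act Sigma) (leaves w) t = q.
Proof.
elim=> [//|{t q cs} t A c B cs _ IH cc ncc].
by rewrite foldl_rcons IH act_cell_edge /flip (negbTE ncc).
Qed.

Lemma built_size t q cs : built t q cs -> size t = size cs.
Proof. by elim=> //= {t q cs} t A c B cs _ <- _ _; rewrite size_rcons. Qed.

Lemma built_cell t q cs c : built t q cs -> c \in cs ->
  is_cell P (labels c.1) c.2 /\ ~~ cancels c.
Proof.
elim=> [//|{t q cs} t A c' B cs _ IH cc' nc'].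
by rewrite in_cons => /orP[/eqP->//|].
Qed.

Local Notation tops cs := (flatten [seq c.1 | c <- cs]).
Local Notation bots cs := (flatten [seq bot c | c <- cs]).

(* Every edge of the diagram lies on the bottom path or on the top path of
   exactly one cell; it lies on the top path [w] or on the bottom path of
   exactly one cell. *)
Lemma built_perm t q cs : built t q cs ->
  perm_eq (q ++ tops cs) (leaves w ++ bots cs).
Proof.
elim=> [|{t q cs} t A c B cs _ IH _ _]; first by rewrite !cats0.
rewrite /= perm_sym perm_catCA.
have : perm_eq (bot c ++ leaves w ++ bots cs)
    (bot c ++ (A ++ c.1 ++ B) ++ tops cs) by rewrite perm_cat2l perm_sym.
move/perm_trans; apply.
rewrite -!catA perm_catCA perm_cat2l perm_cat2l.
by rewrite perm_catCA.
Qed.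

Lemma uniq_bots (cs : seq cell) : uniq cs -> uniq (leaves w ++ bots cs).
Proof.
move=> ucs; rewrite cat_uniq uniq_leaves/=; apply/andP; split.
  apply/hasPn => l /flattenP[_ /mapP[c _ ->]]; exact: bot_notin_leaves.
elim: cs ucs => //= c cs IH /andP[ccs /IH ucs].
rewrite cat_uniq uniq_bot ucs andbT /=.
apply/hasPn => l /flattenP[_ /mapP[c' c'cs ->]] lc'; apply/negP => lc.
by move: ccs; rewrite (mem_bot_inj lc lc') c'cs.
Qed.

(** Crossing a cell again would consume the same named edges twice, whereas by [built_perm] every
    name occurs only once among the current path and the consumed top paths. *)
Lemma built_uniq_cells t q cs : built t q cs -> uniq cs.
Proof.
elim=> [//|{t q cs} t A c B cs bt IH cc _] /=; rewrite IH andbT.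
apply/negP => ccs; have := uniq_bots IH; rewrite -(perm_uniq (built_perm bt)).
have [c0 _] := is_cell_neq0 cc.
have [l lc] : exists l, l \in c.1.
  by apply: mem_nonempty; apply: contraNneq c0 => ->.
have ltops : l \in tops cs by apply/flattenP; exists c.1; rewrite ?map_f.
by rewrite cat_uniq => /and3P[_ /hasPn/(_ l ltops)]; rewrite /= !mem_cat lc orbT.
Qed.

Lemma built_uniq t q cs : built t q cs -> uniq (q ++ tops cs).
Proof.
by move=> bt; rewrite (perm_uniq (built_perm bt)) uniq_bots// (built_uniq_cells bt).
Qed.

Lemma built_uniq_state t q cs : built t q cs -> uniq q.
Proof. by move=> /built_uniq; rewrite cat_uniq => /andP[]. Qed.

Definition maximal (cs : seq cell) (c : cell) :=
  forall c' l, c' \in cs -> l \in bot c -> l \notin c'.1.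

Lemma bot_sub_maximal t q cs c : built t q cs ->
  {subset bot c <= q} -> maximal cs c.
Proof.
move=> /built_uniq; rewrite cat_uniq => /and3P[_ /hasPn nq _] cq c' l c'cs lc.
apply/negP => lc'; have ltops : l \in tops cs.
  by apply/flattenP; exists c'.1; rewrite ?map_f.
by move/negP: (nq l ltops); apply; exact: cq.
Qed.

Lemma built_bot_mem t q cs c l : built t q cs -> l \in bot c ->
  l \in q \/ l \in tops cs -> c \in cs.
Proof.
move=> bt lc; have := perm_mem (built_perm bt) l; rewrite !mem_cat => qE lq.
have : (l \in q) || (l \in tops cs) by apply/orP.
rewrite qE (negbTE (bot_notin_leaves _ lc)) => /flattenP[_ /mapP[c' c'cs ->]] lc'.
by rewrite (mem_bot_inj lc lc').
Qed.

Lemma dequiv_swap t A c M d B :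
  is_path P w t (labels (A ++ c.1 ++ M ++ d.1 ++ B)) ->
  is_cell P (labels c.1) c.2 -> is_cell P (labels d.1) d.2 ->
  dequiv w (labels (A ++ bot c ++ M ++ bot d ++ B))
    (rcons (rcons t (cell_edge A c (M ++ d.1 ++ B)))
           (cell_edge (A ++ bot c ++ M) d B))
    (rcons (rcons t (cell_edge (A ++ c.1 ++ M) d B))
           (cell_edge A c (M ++ bot d ++ B))).
Proof.
move=> pt cc cd; apply: dequiv_exchange.
- have := Exchange t [::] (labels A) (labels c.1) c.2 (labels M)
    (labels d.1) d.2 (labels B).
  by rewrite -!cats1 -!catA /= /cell_edge !labels_cat !labels_bot.
- apply/is_path_rcons; split=> //; last first.
    by rewrite /etgt /= !labels_cat ?labels_bot -?catA.
  apply/is_path_rcons; split=> //; last first.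
    by rewrite /etgt /esrc /= !labels_cat ?labels_bot -?catA.
  by move: pt; rewrite /esrc /= !labels_cat ?labels_bot -?catA.
- apply/is_path_rcons; split=> //; last first.
    by rewrite /etgt /= !labels_cat ?labels_bot -?catA.
  apply/is_path_rcons; split=> //; last first.
    by rewrite /etgt /esrc /= !labels_cat ?labels_bot -?catA.
  by move: pt; rewrite /esrc /= !labels_cat ?labels_bot -?catA.
Qed.

(* A maximal cell can be crossed last. *)
Lemma built_extract t q cs c : built t q cs -> c \in cs -> maximal cs c ->
  exists t' A B cs', [/\ built t' (A ++ c.1 ++ B) cs', q = A ++ bot c ++ B,
    perm_eq cs (c :: cs') &
    dequiv w (labels q) t (rcons t' (cell_edge A c B))].
Proof.
move=> bt; elim: bt c => [//|{t q cs} t A0 c0 B0 cs bt IH cc0 nc0] c.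
have bt' := built_rcons bt cc0 nc0.
rewrite in_cons; case: eqVneq => [-> _ _|ncc0 /= ccs cmax].
  exists t, A0, B0, cs; split=> //; apply: dequiv_refl; exact: built_path bt'.
have [|t' [A [B [cs' [bt1 eq_q cs_perm eq_t]]]]] := IH c ccs.
  by move=> c' l c'cs lc; apply: cmax => //; rewrite in_cons c'cs orbT.
have [cc _] := built_cell bt ccs.
have c00 : c0.1 != [::].
  by have [h _] := is_cell_neq0 cc0; apply: contraNneq h => ->.
have c0_ : bot c != [::] by rewrite bot_eq0; have [] := is_cell_neq0 cc.
(* By maximality the last cell [c0] uses no edge below [c]. The two cells therefore lie side by
   side, and an exchange puts [c] last; the two cases are the two possible sides. *)
have dis : ~~ has (mem c0.1) (bot c).
  by apply/hasPn => l lc; apply: (cmax c0 l) => //; rewrite mem_head.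
have perm' : perm_eq (c0 :: cs) [:: c, c0 & cs'].
  apply: (@perm_trans _ [:: c0, c & cs']); first by rewrite perm_cons.
  exact/permPl/(perm_catCA [:: c0] [:: c]).
have [[M eA eB]|[M eA eB]] := disjoint_factors eq_q c00 c0_ dis.
- subst A0 B; have bt2 : built t' ((A ++ c.1 ++ M) ++ c0.1 ++ B0) cs'.
    by rewrite -!catA.
  have bt3 := built_rcons bt2 cc0 nc0.
  exists (rcons t' (cell_edge (A ++ c.1 ++ M) c0 B0)), A, (M ++ bot c0 ++ B0),
    (c0 :: cs'); split=> //.
  + by move: bt3; rewrite -!catA.
  + by rewrite -!catA.
  + rewrite -!catA; apply: dequiv_trans; last first.
      by apply: dequiv_swap => //; exact: built_path bt1.
    rewrite -[rcons t _]cats1 -[X in dequiv _ _ _ X]cats1.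
    apply: dequiv_cat eq_t _; apply: dequiv_refl.
    rewrite /= /etgt /esrc/= !labels_cat ?labels_bot -?catA; split=> //.
- subst A B0; rewrite -!catA in bt1 eq_t *.
  have bt2 : built t' (A0 ++ c0.1 ++ (M ++ c.1 ++ B)) cs' by [].
  have bt3 := built_rcons bt2 cc0 nc0.
  exists (rcons t' (cell_edge A0 c0 (M ++ c.1 ++ B))), (A0 ++ bot c0 ++ M), B,
    (c0 :: cs'); split=> //.
  + by move: bt3; rewrite -!catA.
  + by rewrite -!catA.
  + apply: dequiv_trans; last first.
      by apply/dequiv_sym/dequiv_swap => //; exact: built_path bt1.
    rewrite -[rcons t _]cats1 -[X in dequiv _ _ _ X]cats1.
    apply: dequiv_cat eq_t _; apply: dequiv_refl.
    rewrite /= /etgt /esrc/= !labels_cat ?labels_bot -?catA; split=> //.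
Qed.

(** * Action of paths on decorated words *)

Definition acts s := foldl (@act Sigma) (leaves w) s.

Lemma is_path_inj x s y z : is_path P x s y -> is_path P x s z -> y = z.
Proof.
elim: s x => [|e s IHs] x /=; first by move=> <-.
by case=> _ _ /IHs IH [_ _ /IH].
Qed.

Lemma cancelsP (c : cell) : cancels c ->
  let c' := (dipole_top c.1, labels c.1) in
  c.1 = bot c' /\ labels c'.1 = c.2.
Proof. by case/andP=> /eqP ? /eqP. Qed.

(** A bottom path that is still entirely on the current path belongs to a maximal cell of [cs],
    which can be crossed last. Since the letters of a state are distinct, it sits between [A] and
    [B]. *)
Lemma built_extract_bot t A c B cs : is_cell P (labels c.1) c.2 ->
  built t (A ++ bot c ++ B) cs ->
  exists t' cs', [/\ built t' (A ++ c.1 ++ B) cs', c \in cs,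
    perm_eq cs (c :: cs') &
    dequiv w (labels (A ++ bot c ++ B)) t (rcons t' (cell_edge A c B))].
Proof.
move=> cc bt; have c0 : bot c != [::] by rewrite bot_eq0; have [] := is_cell_neq0 cc.
have sub : {subset bot c <= A ++ bot c ++ B}.
  by move=> l lc; rewrite !mem_cat lc orbT.
have ccs : c \in cs.
  have [l lc] := mem_nonempty c0.
  by apply: (built_bot_mem bt lc); left; exact: sub.
have [t' [A' [B' [cs' [bt' eq_q cs_perm eq_t]]]]] :=
  built_extract bt ccs (bot_sub_maximal bt sub).
have [eA eB] := uniq_factor (built_uniq_state bt) c0 eq_q.
by subst A' B'; exists t', cs'.
Qed.

(** Computes reduced forms. Edge by edge, the new cell is either added or forms a dipole with a
    maximal cell of the diagram built so far, and then both disappear. *)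
Lemma reach s y : is_path P w s y ->
  exists t cs, built t (acts s) cs /\ dequiv w y s t.
Proof.
elim/last_ind: s y => [|s e IHs] y.
  by move=> p; exists [::], [::]; split; [exact: built_nil|exact: dequiv_refl].
move=> pse; have /is_path_rcons[ps ce ey] := pse.
have [t [cs [bt st]]] := IHs _ ps.
have [_ pt] := dequiv_path st.
have := is_path_inj (built_path bt) pt; rewrite /acts foldl_rcons -/(acts s).
move=> /labels_catP[A [U [B [qE]]]]; rewrite {}qE in bt *.
case: e => a u v b /= in ce ey ps pse st pt * => eA eU eB; subst a u b.
rewrite -[Edge _ _ _ _]/(cell_edge A (U, v) B) in pse *.
rewrite (act_cell_edge A (U, v) B) /flip.
have pe : is_path P (labels (A ++ U ++ B)) [:: cell_edge A (U, v) B] y.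
  by split=> //; rewrite /esrc/= !labels_cat.
have ps' : esrc (cell_edge A (U, v) B) = labels (A ++ U ++ B).
  by rewrite /esrc /= !labels_cat.
case: ifPn => [/cancelsP/= | nc]; last first.
  exists (rcons t (cell_edge A (U, v) B)), ((U, v) :: cs); split.
    exact: built_rcons.
  rewrite -!cats1; apply: dequiv_cat (dequiv_refl pe).
  by rewrite -ps'.
(* The last edge undoes [c]: bring [c] to the end of [t], then remove the dipole. *)
set c := (_, _); rewrite -[dipole_top U]/(c.1) => -[eU eV].
have cc : is_cell P (labels c.1) c.2 by rewrite eV; apply: is_cellC.
rewrite eU in bt.
have [t' [cs' [bt' _ _ tt']]] := built_extract_bot cc bt.
exists t', cs'; split=> //.
apply: (@dequiv_trans _ _ _ (rcons t (cell_edge A (U, v) B))).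
  by rewrite -!cats1; apply: dequiv_cat (dequiv_refl pe); rewrite -ps'.
apply: (@dequiv_trans _ _ _
  (rcons (rcons t' (cell_edge A c B)) (cell_edge A (U, v) B))).
  rewrite -!cats1 in tt' *; apply: dequiv_cat (dequiv_refl pe).
  by rewrite [in labels _]eU.
have yE : y = labels (A ++ c.1 ++ B).
  by rewrite -ey /etgt/= !labels_cat eV.
apply: dequiv_dipole.
- have := DipoleRemoval t' [::] (cell_edge A c B).
  by rewrite /einv /= eV !cats0 -!cats1 -catA.
- rewrite -cats1; apply: is_path_cat pe; rewrite [in labels _]eU.
  by case/dequiv_path: tt'.
- by rewrite yE; exact: built_path bt'.
Qed.

Lemma labels_acts s y : is_path P w s y -> labels (acts s) = y.
Proof.
move=> ps; have [t [cs [bt st]]] := reach ps.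
by apply: is_path_inj (built_path bt) _; case/dequiv_path: st.
Qed.

(** If [e] adds a cell, its inverse cancels that cell. If [e] cancels a cell [c], its inverse adds
    [c] back, because [c] was built and so is not itself cancelling. *)
Lemma act_einv s e y : is_path P w (rcons s e) y ->
  act (act (acts s) e) (einv e) = acts s.
Proof.
case/is_path_rcons => ps ce _; have [t [cs [bt _]]] := reach ps.
have /labels_catP[A [U [B [qE]]]] := labels_acts ps; rewrite {}qE in bt *.
case: e => a u v b /= in ce ps * => eA eU eB; subst a u b.
rewrite (act_cell_edge A (U, v) B) /flip /einv /=.
have [u0 v0] := is_cell_neq0 ce.
case: ifPn => [/cancelsP/= | nc]; last first.
  rewrite act_cat ?(size_bot (U, v)) ?size_map//.
  by rewrite -[bot _]/(bot (U, v)) (@flip_bot _ (U, v)).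
set c := (_, _); rewrite -[dipole_top U]/(c.1) => -[eU eV].
have cc : is_cell P (labels c.1) c.2 by rewrite eV; apply: is_cellC.
rewrite -eV act_cat ?size_map// [c.1 as X in (X, _)]/(c.1).
rewrite eU in bt; have [t' [cs' [_ ccs _ _]]] := built_extract_bot cc bt.
have [_ nc] := built_cell bt ccs.
by rewrite -[(_, _)]/c /flip (negbTE nc) -eU.
Qed.

Lemma acts_cat s t : acts (s ++ t) = foldl (@act Sigma) (acts s) t.
Proof. exact: foldl_cat. Qed.

Lemma act_exchange A U1 (v1 : word) B U2 (v2 : word) C (b b' : word) :
  let q := A ++ U1 ++ B ++ U2 ++ C in
  act (act q (Edge (labels A) (labels U1) v1 b))
    (Edge (labels A ++ v1 ++ labels B) (labels U2) v2 (labels C)) =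
  act (act q (Edge (labels A ++ labels U1 ++ labels B) (labels U2) v2 (labels C)))
    (Edge (labels A) (labels U1) v1 b').
Proof.
move=> /=; rewrite (@act_cat _ A U1) ?size_map//.
have sF : size (A ++ flip (U1, v1) ++ B) = size (labels A ++ v1 ++ labels B).
  by rewrite -[v1 in RHS]/((U1, v1).2) -labels_flip -!labels_cat size_map.
have -> : A ++ flip (U1, v1) ++ B ++ U2 ++ C =
  (A ++ flip (U1, v1) ++ B) ++ U2 ++ C by rewrite -!catA.
have -> : A ++ U1 ++ B ++ U2 ++ C = (A ++ U1 ++ B) ++ U2 ++ C.
  by rewrite -!catA.
rewrite (@act_cat _ _ _ _ _ _ _ _ sF) ?size_map//.
by rewrite act_cat -?labels_cat ?size_map// -!catA act_cat ?size_map.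
Qed.

(** Exchanges and dipole removals preserve the decorated word, which is thus an invariant of the
    class of a diagram. *)
Lemma acts_dequiv y s t : dequiv w y s t -> acts s = acts t.
Proof.
case=> D [E [<- <- DE]].
elim: DE => {D E} [D E DE|//|D E _ ->//|D E F _ -> _ ->//].
have := diagram_path D; case: DE => -[].
- move=> s1 s2 a u1 v1 b u2 v2 c /is_path_catE[x p1 /= [_ ex _]].
  rewrite !acts_cat /=; congr foldl; move: (labels_acts p1).
  rewrite -{}ex /esrc/= => /labels_catP[A [U1 [Q [-> <- <- +]]]].
  move=> /labels_catP[B [U2 [C [-> <- <- <-]]]].
  exact: act_exchange.
- move=> s1 s2 e /is_path_catE[x p1 /= [ce ex _]].
  rewrite !acts_cat /= (@act_einv s1 e (etgt e))//.
  by apply/is_path_rcons; split=> //; rewrite ex.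
Qed.

(** * Recovering diagrams from their cells, and geodesics *)

Lemma cells_cat (q r : seq (letter Sigma)) c :
  (c \in cells (q ++ r)) = (c \in cells q) || (c \in cells r).
Proof. by rewrite !mem_cells has_cat. Qed.

Lemma mem_canc (c c' : cell) : (c' \in canc c) = (c' == c) || (c' \in cells c.1).
Proof. by rewrite in_cons mem_undup. Qed.

Lemma cells_bot (c : cell) : bot c != [::] -> cells (bot c) =i canc c.
Proof.
move=> /mem_nonempty[l lc] c'; rewrite mem_cells.
apply/hasP/idP => [[l' /anc_bot->]//|]; exists l => //.
by rewrite (anc_bot lc).
Qed.

(** No cell is forgotten: crossing [c] hides the edges [c.1], but their histories are contained in
    those of the non-empty path [bot c]. *)
Lemma built_cells t q cs : built t q cs -> cs =i cells q.
Proof.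
elim=> [|{t q cs} t A c B cs bt IH cc _] d.
  rewrite mem_cells in_nil; apply/esym/hasPn => l /mapP[p _ ->].
  by [].
rewrite in_cons IH !cells_cat cells_bot ?mem_canc.
  by case: (d == c); rewrite /= ?orbT.
by rewrite bot_eq0; have [] := is_cell_neq0 cc.
Qed.

Lemma built_perm_cells t q cs : built t q cs -> perm_eq cs (cells q).
Proof.
move=> bt; apply: uniq_perm (built_cells bt); last exact: undup_uniq.
exact: built_uniq_cells bt.
Qed.

Lemma built_parent t q cs c c' l : built t q cs -> c' \in cs -> l \in bot c ->
  l \in c'.1 -> c \in cs.
Proof.
move=> bt c'cs lc lc'; apply: built_bot_mem bt lc _; right.
by apply/flattenP; exists c'.1; rewrite ?map_f.
Qed.

(** The last cell of the first diagram is maximal in the common set of cells, so it can be made last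
    in the second one too; induction applies to what remains. *)
Lemma built_inj t1 q1 cs1 t2 q2 cs2 : built t1 q1 cs1 -> built t2 q2 cs2 ->
  cs1 =i cs2 -> q1 = q2 /\ dequiv w (labels q1) t1 t2.
Proof.
move=> bt1; elim: bt1 t2 q2 cs2 => [|{t1 q1 cs1} t1 A c B cs bt IH cc nc] t2 q2 cs2 bt2.
  move=> cs2E; have : size cs2 = 0%N.
    by case: cs2 cs2E {bt2} => // d cs2 /(_ d); rewrite mem_head.
  have := built_path bt2; have := built_acts bt2; rewrite -(built_size bt2).
  by move=> <- + /size0nil t20; rewrite t20 /=; split=> //; exact: dequiv_refl.
move=> cs12; have ccs2 : c \in cs2 by rewrite -cs12 mem_head.
have bt' := built_rcons bt cc nc.
have cmax : maximal cs2 c.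
  move=> c' l; rewrite -cs12 => c'cs; apply: (bot_sub_maximal bt') c'cs.
  by move=> l' lc; rewrite !mem_cat lc orbT.
have [t2' [A2 [B2 [cs2' [bt2' -> cs2P t2t2']]]]] := built_extract bt2 ccs2 cmax.
have [|eq_q tt2'] := IH _ _ _ bt2'.
  move=> d; rewrite (mem_perm_cons (built_uniq_cells bt2) cs2P) -cs12.
  exact: (mem_perm_cons (built_uniq_cells bt')).
have c0 : c.1 != [::].
  by have [h _] := is_cell_neq0 cc; apply: contraNneq h => ->.
have [eA eB] := uniq_factor (built_uniq_state bt) c0 eq_q; subst A2 B2.
split=> //; apply: dequiv_trans (dequiv_sym t2t2').
rewrite -!cats1; apply: dequiv_cat tt2' (dequiv_refl _); split=> //.
  by rewrite /esrc/= !labels_cat.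
by rewrite /etgt /= !labels_cat labels_bot.
Qed.

(** Take a cell of the difference with largest [csize]. A cell of [cs1] just below it would belong
    to [cs2], and so would its parent; hence the chosen cell is maximal. *)
Lemma built_extract_diff t1 q1 cs1 t2 q2 cs2 :
  built t1 q1 cs1 -> built t2 q2 cs2 -> has (fun c => c \notin cs2) cs1 ->
  exists t' A c B cs', [/\ built t' (A ++ c.1 ++ B) cs', q1 = A ++ bot c ++ B,
    c \notin cs2, perm_eq cs1 (c :: cs') &
    dequiv w (labels q1) t1 (rcons t' (cell_edge A c B))].
Proof.
move=> bt1 bt2 hasc.
have [|c] := @exists_max _ (@csize _) [seq c <- cs1 | c \notin cs2].
  by rewrite -has_filter.
rewrite mem_filter => /andP[ccs2 ccs1] cmax.
have [|t' [A [B [cs' [bt' eq_q cs_perm eq_t]]]]] := built_extract bt1 ccs1.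
  move=> c' l c'cs lc; apply/negP => lc'; have lt := csize_lt lc lc'.
  have [c'cs2|c'cs2] := boolP (c' \in cs2).
    by move: ccs2; rewrite (built_parent bt2 c'cs2 lc lc').
  by have := cmax c'; rewrite mem_filter c'cs2 c'cs leqNgt lt => /(_ isT).
by exists t', A, c, B, cs'.
Qed.

Lemma dequiv_cancel t A c B p y t2 : is_cell P (labels c.1) c.2 ->
  is_path P w t (labels (A ++ c.1 ++ B)) -> dequiv w y (t ++ p) t2 ->
  dequiv w y (rcons t (cell_edge A c B) ++ einv (cell_edge A c B) :: p) t2.
Proof.
move=> cc pt eq_t; apply: dequiv_trans (eq_t).
have [/is_path_catE[x pt' pp] _] := dequiv_path eq_t.
have ex := is_path_inj pt pt'; subst x.
apply: dequiv_dipole.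
- by rewrite cat_rcons; exact: DipoleRemoval.
- rewrite cat_rcons; apply: is_path_cat pt _; split=> //.
    by rewrite /esrc/= !labels_cat.
  by split=> //=; [exact: is_cellC|rewrite /etgt/= -!labels_cat].
- exact: is_path_cat pt pp.
Qed.

(* Going from one diagram to another, the cells that are not common to both are
   removed, then added, each once. *)
Lemma geodesic t1 q1 cs1 t2 q2 cs2 : built t1 q1 cs1 -> built t2 q2 cs2 ->
  exists2 p, dequiv w (labels q2) (t1 ++ p) t2 &
    (size p <= count (fun c => c \notin cs2) cs1 +
               count (fun c => c \notin cs1) cs2)%N.
Proof.
move=> bt1 bt2; have [n] := ubnP (count (fun c => c \notin cs2) cs1 +
               count (fun c => c \notin cs1) cs2)%N.
elim: n => // n IHn in t1 q1 cs1 t2 q2 cs2 bt1 bt2 * => le_n.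
have count_perm (c : cell) (cs cs' ds : seq cell) :
    perm_eq cs (c :: cs') -> c \notin ds ->
    count (fun c => c \notin ds) cs = (count (fun c => c \notin ds) cs').+1.
  by move=> /permP-> /= ->.
have count_notin (c : cell) (cs cs' ds : seq cell) :
    uniq cs -> perm_eq cs (c :: cs') ->
    c \notin ds ->
    count (fun c => c \notin cs) ds = count (fun c => c \notin cs') ds.
  move=> ucs csP cds; apply: eq_in_count => d dds.
  rewrite (mem_perm_cons ucs csP).
  by case: eqVneq => // edc; move: cds; rewrite -edc dds.
(* A cell proper to the first diagram is removed at the start of [p]. *)
have [h1|h1] := boolP (has (fun c => c \notin cs2) cs1).
  have [t' [A [c [B [cs' [bt' eq_q ccs2 cs_perm eq_t]]]]]] :=
    built_extract_diff bt1 bt2 h1.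
  have c1 := count_perm _ _ _ _ cs_perm ccs2.
  have c2 := count_notin _ _ _ _ (built_uniq_cells bt1) cs_perm ccs2.
  have [|p eq_p le_p] := IHn _ _ _ _ _ _ bt' bt2.
    by move: le_n; rewrite c1 c2 addSn ltnS.
  exists (einv (cell_edge A c B) :: p); last by rewrite c1 c2 addSn ltnS.
  have [cc _] : is_cell P (labels c.1) c.2 /\ ~~ cancels c.
    by apply: built_cell bt1 _; rewrite (perm_mem cs_perm) mem_head.
  apply: dequiv_trans (dequiv_cancel cc (built_path bt') eq_p).
  apply: dequiv_cat eq_t _; apply: dequiv_refl.
  have [/is_path_catE[x px pp] _] := dequiv_path eq_p.
  rewrite (is_path_inj px (built_path bt')) in pp.
  split=> //=; first exact: is_cellC.
    by rewrite /esrc/= eq_q !labels_cat labels_bot.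
  by rewrite /etgt/= -!labels_cat.
(* A cell proper to the second diagram is added at the end of [p]. *)
have [h2|h2] := boolP (has (fun c => c \notin cs1) cs2).
  have [t' [A [c [B [cs' [bt' eq_q ccs1 cs_perm eq_t]]]]]] :=
    built_extract_diff bt2 bt1 h2.
  have c1 := count_perm _ _ _ _ cs_perm ccs1.
  have c2 := count_notin _ _ _ _ (built_uniq_cells bt2) cs_perm ccs1.
  have [|p eq_p le_p] := IHn _ _ _ _ _ _ bt1 bt'.
    by move: le_n; rewrite c1 c2 addnS ltnS.
  exists (rcons p (cell_edge A c B)); last by rewrite size_rcons c1 c2 addnS ltnS.
  have [cc _] : is_cell P (labels c.1) c.2 /\ ~~ cancels c.
    by apply: built_cell bt2 _; rewrite (perm_mem cs_perm) mem_head.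
  apply: dequiv_trans (dequiv_sym eq_t).
  rewrite -rcons_cat -!cats1; apply: dequiv_cat eq_p (dequiv_refl _).
  split=> //; first by rewrite /esrc/= !labels_cat.
  by rewrite /etgt/= eq_q !labels_cat labels_bot.
have cs12 : cs1 =i cs2.
  move=> c; apply/idP/idP => ccs; apply: contraT => ccs'.
    by case/hasP: h1; exists c.
  by case/hasP: h2; exists c.
have [eq_q t12] := built_inj bt1 bt2 cs12.
by exists [::] => //; rewrite cats0 -eq_q.
Qed.

(** * Antichains of cells and cubes of the Squier complex *)

Definition antichain (L : seq cell) :=
  forall c c', c \in L -> c' \in L -> c \in canc c' -> c = c'.

Lemma exists_maximal t q cs c : built t q cs -> c \in cs ->
  exists c', [/\ c' \in cs, c \in canc c' & maximal cs c'].
Proof.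
move=> bt ccs.
have [|c'] := @exists_max _ (@csize _) [seq c' <- cs | c \in canc c'].
  by rewrite -has_filter; apply/hasP; exists c => //; exact: canc_refl.
rewrite mem_filter => /andP[cc' c'cs] cmax; exists c'; split=> //.
move=> d l dcs lc'; apply/negP => ld.
have := cmax d; rewrite mem_filter dcs andbT.
rewrite (canc_trans cc' (canc_parent lc' ld)) leqNgt (csize_lt lc' ld).
by move=> /(_ isT).
Qed.

(** Scan [q] from the left. Its first letter starts the bottom path of a cell of [L] or belongs to a
    gap, and bottom paths of distinct cells are disjoint. Each entry of [ts] is a gap followed by a
    cell; [tl] is the last gap. *)
Lemma side_by_side (q : seq (letter Sigma)) (L : seq cell) : uniq q -> uniq L ->
  (forall c, c \in L -> c.2 != [::] /\ exists A B, q = A ++ bot c ++ B) ->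
  exists ts tl, [/\ q = foldr (fun p r => p.1 ++ bot p.2 ++ r) tl ts,
    size ts = size L & forall p, p \in ts -> p.2 \in L].
Proof.
have [n] := ubnP (size q); elim: n q L => // n IHn [|x q] L le_n uq uL qL.
  exists [::], [::]; split=> //; case: L {uL} qL => // c L /(_ c).
  rewrite mem_head => -[//|c0 [A [B /(congr1 size)]]].
  rewrite !size_cat size_bot addnCA /= => /esym/eqP.
  by rewrite addn_eq0 size_eq0 (negbTE c0).
have [/hasP[c cL xc]|nx] := boolP (has (fun c => x \in bot c) L).
  have [c0 [[|y A] [B qE]]] := qL c cL; last first.
    by case: qE uq => _ -> /=; rewrite !mem_cat xc orbT.
  rewrite /= in qE.
  have uB : uniq B by move: uq; rewrite qE cat_uniq => /and3P[].
  have [|||ts [tl [BE sts tsL]]] := IHn B (rem c L) _ uB.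
  - rewrite -ltnS; apply: leq_trans le_n; rewrite qE size_cat size_bot ltnS.
    by case: (c.2) c0 => //= a v _; rewrite addSn ltnS leq_addl.
  - exact: rem_uniq.
  - move=> d; rewrite (mem_rem_uniq _ uL) inE => /andP[dc dL].
    have [d0 [A [B' qE']]] := qL d dL; split=> //.
    have bd0 : bot d != [::] by rewrite bot_eq0.
    have bc0 : bot c != [::] by rewrite bot_eq0.
    (* As [bot c] is a prefix of [q], every other bottom path lies in the rest [B]. *)
    have /disjoint_factors : [::] ++ bot c ++ B = A ++ bot d ++ B' by rewrite /= -qE.
    move=> /(_ bc0 bd0)[|[M + _]|[M _ ->]].
    + apply/hasPn => l ld; apply: contra dc => lc.
      by rewrite (mem_bot_inj ld lc).
    + by case: A {qE'} => //; case: (bot d) bd0.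
    + by exists M, B'.
  - exists (([::], c) :: ts), tl; split=> /=; first by rewrite -BE.
      rewrite sts size_rem//; case: (L) cL => //.
    move=> p; rewrite in_cons => /orP[/eqP->//|/tsL]; exact: mem_rem.
have [||| ts [tl [BE sts tsL]]] := IHn q L _ _ uL.
- by [].
- by case/andP: uq.
- move=> c cL; have [c0 [[|y A] [B qE]]] := qL c cL; split=> //.
    have := hasPn nx c cL; rewrite -bot_eq0 in c0.
    by case: (bot c) c0 qE => // y b _ [<- _]; rewrite mem_head.
  by exists A, B; case: qE.
- case: ts BE sts tsL => [|[a c] ts] BE sts tsL.
    by exists [::], (x :: tl); rewrite BE.
  exists ((x :: a, c) :: ts), tl; split=> //; first by rewrite BE.
  move=> p; rewrite in_cons => /orP[/eqP->|pts].
    by rewrite (tsL (a, c)) ?mem_head.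
  by apply: tsL; rewrite in_cons pts orbT.
Qed.

Lemma connected_words_trans x y z :
  connected_words P x y -> connected_words P y z -> connected_words P x z.
Proof. by move=> [s ps] [t pt]; exists (s ++ t); apply: is_path_cat ps pt. Qed.

Definition bottom_vertex (c : cube Sigma) : word :=
  foldr (fun p r => p.1 ++ p.2.2 ++ r) c.2 c.1.

Lemma cube_connected (c : cube Sigma) (a x : word) : is_cube P c ->
  x \in cube_vertices c -> connected_words P (a ++ bottom_vertex c) (a ++ x).
Proof.
case: c => ts tl; rewrite /cube_vertices /bottom_vertex /=.
elim: ts a x => [|[a1 [u v]] ts IH] a x cP /=.
  by rewrite inE => /eqP->; exists [::].
rewrite cats0 mem_cat => xP.
have {xP} [z [x' [zuv x'ts ->]]] : exists z x', [/\ z \in [:: u; v],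
    x' \in cube_vertices_rec ts tl & x = a1 ++ z ++ x'].
  by case/orP: xP => /mapP[x' x'ts ->]; [exists u|exists v]; exists x';
     rewrite !inE eqxx ?orbT.
have cuv : is_cell P u v by apply: (cP (a1, (u, v))); rewrite mem_head.
have IH' := IH (a ++ a1 ++ v) x' _ x'ts; rewrite -!catA in IH'.
apply: connected_words_trans (IH' _) _.
  by move=> t tts; apply: cP; rewrite in_cons tts orbT.
move: zuv; rewrite !inE => /orP[/eqP->|/eqP->]; last by exists [::].
exists [:: Edge (a ++ a1) v u x']; split=> /=; first exact: is_cellC.
  by rewrite /esrc /= -!catA.
by rewrite /etgt /= -!catA.
Qed.

Definition cubes_bounded (N : nat) := forall c : cube Sigma, is_cube P c ->
  (forall x, x \in cube_vertices c -> connected_words P w x) ->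
  (cube_dim c <= N)%N.

(** The bottom paths of maximal cells are disjoint factors of the current path, so these cells span
    a cube with [labels q] as a vertex, hence in the component of [w]. *)
Lemma maximal_cells_bound N t q cs L : cubes_bounded N -> built t q cs ->
  uniq L -> {subset L <= cs} -> (forall c, c \in L -> maximal cs c) ->
  (size L <= N)%N.
Proof.
move=> dimN bt uL Lcs Lmax.
have [|ts [tl [qE sts tsL]]] := @side_by_side q L (built_uniq_state bt) uL.
  move=> c cL; have [cc _] := built_cell bt (Lcs c cL).
  have [_ ?] := is_cell_neq0 cc; split=> //.
  have [t' [A [B [cs' [_ -> _ _]]]]] := built_extract bt (Lcs c cL) (Lmax c cL).
  by exists A, B.
pose c : cube Sigma :=
  ([seq (labels p.1, (labels p.2.1, p.2.2)) | p <- ts], labels tl).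
have qc : labels q = bottom_vertex c.
  rewrite qE /c /bottom_vertex /=; elim: (ts) => //= p ts' <-.
  by rewrite !labels_cat labels_bot.
have cP : is_cube P c.
  move=> _ /mapP[p pts ->] /=.
  by have [] := built_cell bt (Lcs _ (tsL p pts)).
have := dimN c cP; rewrite /cube_dim size_map sts; apply.
move=> x /(cube_connected [::] cP); rewrite /= -qc.
by apply: connected_words_trans; exists t; exact: built_path bt.
Qed.

(** Peel off maximal cells outside [L] as long as there are any. Then each cell of [L] has a maximal
    cell weakly below it, which is in [L] and so equal to it: [L] consists of maximal cells. *)
Lemma antichain_bound N t q cs L : cubes_bounded N -> built t q cs ->
  uniq L -> {subset L <= cs} -> antichain L -> (size L <= N)%N.
Proof.
move=> dimN + uL; have [n] := ubnP (size cs).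
elim: n => // n IHn in t q cs * => le_n bt Lcs Lanti.
have [[c [ccs cmax cL]]|h] :=
    pselect (exists c, [/\ c \in cs, maximal cs c & c \notin L]).
  have [t' [A [B [cs' [bt' _ csP _]]]]] := built_extract bt ccs cmax.
  apply: IHn bt' _ Lanti.
    by move: le_n; rewrite (perm_size csP) /= ltnS.
  move=> d dL; rewrite (mem_perm_cons (built_uniq_cells bt) csP) (Lcs d dL) andbT.
  by apply: contraNneq cL => <-.
apply: (maximal_cells_bound dimN bt uL Lcs) => c cL.
have [c' [c'cs cc' c'max]] := exists_maximal bt (Lcs c cL).
have c'L : c' \in L by apply: contraPT (h) => c'L _; apply: h; exists c'.
by rewrite (Lanti c c').
Qed.

(* The number of cells weakly below [c]; cells with the same value are pairwise
   incomparable. *)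
Definition depth (q : seq (letter Sigma)) (c : cell) : nat :=
  count (fun c' => c \in canc c') (cells q).

Lemma depth_level_bound N t q cs k : cubes_bounded N -> built t q cs ->
  (count (fun c => depth q c == k) (cells q) <= N)%N.
Proof.
move=> dimN bt; rewrite -size_filter.
apply: (antichain_bound dimN bt).
- by rewrite filter_uniq// undup_uniq.
- by move=> c; rewrite mem_filter (built_cells bt) => /andP[].
move=> c c'; rewrite !mem_filter => /andP[/eqP ck cq] /andP[/eqP c'k c'q] cc'.
(* Everything weakly below [c'] is weakly below [c], and [c] itself is counted only for [c]. *)
apply: contraTeq isT => ncc'; have : (depth q c' < depth q c)%N; last first.
  by rewrite ck c'k ltnn.
apply: (@count_lt _ _ _ _ c) => //; first by move=> d; exact: canc_trans.
  exact: canc_refl.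
by apply: contra ncc' => c'c; rewrite (canc_antisym cc' c'c).
Qed.

(** The cells of a state are closed under ancestors. *)
Lemma depth_gt0 t q cs c : built t q cs -> (0 < depth q c)%N = (c \in cells q).
Proof.
move=> bt; rewrite -has_count; apply/hasP/idP => [[c' c'q cc']|cq]; last first.
  by exists c => //; exact: canc_refl.
move: c'q; rewrite !mem_cells => /hasP[l lq c'l]; apply/hasP; exists l => //.
case: l c'l {lq} => // U v j x; exact: (canc_trans cc').
Qed.

Lemma depth_le q c : (depth q c <= size (cells q))%N.
Proof. exact: count_size. Qed.

Lemma depth_built_rcons t A c B cs d : built t (A ++ c.1 ++ B) cs ->
  is_cell P (labels c.1) c.2 -> ~~ cancels c ->
  depth (A ++ bot c ++ B) d = ((d \in canc c) + depth (A ++ c.1 ++ B) d)%N.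
Proof.
move=> bt cc nc; have bt' := built_rcons bt cc nc.
by rewrite /depth -(permP (built_perm_cells bt')) -(permP (built_perm_cells bt)).
Qed.

End Reachable.

(** * Sums of powers *)

Section PowerSums.
Variable R : realType.
Implicit Types (e b : R) (k m n N : nat).

(** Factor out [k ^ e] and use [(1 + 1/k) ^ e <= 1 + 1/k]. *)
Lemma powR_increment e k : 0 <= e <= 1 -> (0 < k)%N ->
  k.+1%:R `^ e - k%:R `^ e <= k%:R `^ (e - 1) :> R.
Proof.
move=> /andP[e0 e1] k0; have kR : 0 < k%:R :> R by rewrite ltr0n.
have -> : k.+1%:R = k%:R * (1 + k%:R^-1) :> R.
  by rewrite mulrDr mulr1 divff ?gt_eqF// -natr1.
have k1 : 1 <= 1 + k%:R^-1 :> R by rewrite lerDl invr_ge0 ltW.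
rewrite powRM; [|exact: ltW|exact: le_trans ler01 k1].
have : (1 + k%:R^-1) `^ e <= 1 + k%:R^-1 :> R.
  exact: ler1_powR.
move=> /(ler_wpM2l (powR_ge0 k%:R e)); rewrite mulrDr mulr1 => h.
rewrite powRB ?powRr1 ?(gt_eqF kR) ?implybT ?(ltW kR)//.
by rewrite lerBlDl.
Qed.

(** Factor out [(k+1) ^ (-b)]. With [r = k/(k+1)], one has [r ^ (-b) = exp (- b * ln r) >= 1 - b *
    ln r], and [ln r <= - 1/(k+1)]. *)
Lemma powR_decrement b k : 0 < b -> (0 < k)%N ->
  b * k.+1%:R `^ (- b - 1) <= k%:R `^ (- b) - k.+1%:R `^ (- b) :> R.
Proof.
move=> b0 k0; have kR : 0 < k%:R :> R by rewrite ltr0n.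
have k1R : 0 < k.+1%:R :> R by rewrite ltr0n.
have r0 : 0 < k%:R / k.+1%:R :> R by rewrite divr_gt0.
have -> : k%:R = k.+1%:R * (k%:R / k.+1%:R) :> R.
  by rewrite mulrCA divff ?mulr1// gt_eqF.
rewrite powRM ?(ltW k1R) ?(ltW r0)// powRB ?(gt_eqF k1R) ?implybT//.
rewrite powRr1 ?(ltW k1R)//.
set p := k.+1%:R `^ - b; have p0 : 0 <= p by exact: powR_ge0.
rewrite -[X in _ - X]mulr1 -mulrBr mulrCA ler_wpM2l//.
rewrite /powR gt_eqF// lerBrDl.
apply: le_trans (expR_ge1Dx _).
rewrite lerD2l mulNr -mulrN ler_wpM2l ?(ltW b0)//.
have h : -1 < - k.+1%:R^-1 :> R by rewrite ltrN2 invf_lt1// ltr1n ltnS.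
have := le_ln1Dx h; rewrite (_ : 1 - _ = k%:R / k.+1%:R); first by rewrite lerNr.
apply: (mulIf (lt0r_neq0 k1R)).
by rewrite mulrBl mul1r mulVf ?divfK ?gt_eqF// -natr1 addrK.
Qed.

(** For [k > 0], the square of the bound [k ^ (e - 1)] on increments; it is summable because
    [2 * e - 2 < -1] when [e < 1/2]. *)
Definition decay e k : R := if k is 0 then 0 else k%:R `^ (2 * e - 2).

Lemma decay_ge0 e k : 0 <= decay e k.
Proof. by case: k => //= k; exact: powR_ge0. Qed.

(** The exponent is [- b - 1], so [powR_decrement] makes the terms after [k = 1] telescope. *)
Lemma sum_decay_le e m : 0 < e -> e < 2^-1 ->
  \sum_(0 <= k < m) decay e k <= 1 + (1 - 2 * e)^-1.
Proof.
move=> e0 e1; set b := 1 - 2 * e; have b0 : 0 < b by rewrite /b; lra.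
have aux n : \sum_(0 <= k < n.+2) decay e k <= 1 + b^-1 * (1 - n.+1%:R `^ (- b)).
  elim: n => [|n IHn].
    by rewrite /index_iota /= !big_cons big_nil /= !powR1 subrr mulr0 add0r addr0.
  rewrite big_nat_recr//=.
  have := @powR_decrement b n.+1 b0 isT.
  rewrite (_ : - b - 1 = 2 * e - 2); last by rewrite /b; ring.
  rewrite -ler_pdivlMl// mulrC => h.
  have := lerD IHn h; move/le_trans; apply.
  by rewrite -addrA lerD2l [_^-1 * (_ `^ _ - _)]mulrC; lra.
have [|m1] := leqP m 1.
  case: m => [|[|//]] _; rewrite ?big_nat1 ?big_geq//=;
  by rewrite addr_ge0// invr_ge0 ltW.
rewrite -(subnK m1) addn2; apply: le_trans (aux _) _.
by rewrite lerD2l -[leRHS]mulr1 ler_wpM2l ?invr_ge0 ?(ltW b0)// gerBl powR_ge0.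
Qed.

Lemma sqr_increment_le e k (d : bool) : 0 < e -> e < 2^-1 -> (0 < k)%N ->
  ((d + k)%N%:R `^ e - k%:R `^ e) ^+ 2 <= decay e k.
Proof.
move=> e0 e1 k0; case: d; last by rewrite subrr expr0n decay_ge0.
have kR : 0 < k%:R :> R by rewrite ltr0n.
have -> : decay e k = (k%:R `^ (e - 1)) ^+ 2.
  rewrite -powR_mulrn ?powR_ge0// -powRrM /decay; case: k k0 {kR} => // k _.
  by congr (_ `^ _); ring.
rewrite ler_sqr ?nnegrE ?powR_ge0 ?subr_ge0//.
  by apply: powR_increment => //; apply/andP; split; lra.
by apply: ge0_ler_powR; rewrite ?nnegrE ?ler_nat ?leq_addl ?ler0n// (ltW e0).
Qed.

Lemma sum_levels (T : eqType) (s : seq T) (h : T -> nat) (g : nat -> R) N m :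
  (forall k, 0 <= g k) -> (forall k, count (fun c => h c == k) s <= N)%N ->
  (forall c, c \in s -> h c < m)%N ->
  \sum_(c <- s) g (h c) <= N%:R * \sum_(0 <= k < m) g k.
Proof.
move=> g0 hN hm.
have -> : \sum_(c <- s) g (h c) =
    \sum_(c <- s) \sum_(0 <= k < m | h c == k) g k.
  rewrite !big_seq; apply: eq_bigr => c cs.
  rewrite big_mkord (bigD1 (Ordinal (hm c cs)))//= big1 ?addr0//.
  by move=> i /andP[/eqP hi]; rewrite -val_eqE/= hi eqxx.
rewrite (exchange_big_dep predT)//= mulr_sumr.
apply: ler_sum => k _; rewrite big_const_seq iter_addr_0.
by rewrite -[X in X <= _]mulr_natl ler_wpM2r// ler_nat.
Qed.

Lemma count_le_levels (T : eqType) (s : seq T) (h : T -> nat) N m :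
  (forall k, count (fun c => h c == k) s <= N)%N ->
  (forall c, c \in s -> 0 < h c)%N ->
  (count (fun c => h c <= m)%N s <= N * m)%N.
Proof.
move=> hN h0; elim: m => [|m IHm].
  rewrite muln0 leqn0 -leqn0 leqNgt -has_count; apply/hasPn => c /h0.
  by rewrite leqn0 lt0n.
rewrite mulnS addnC; apply: leq_trans (leq_add IHm (hN m.+1)).
rewrite -count_predUI; apply: leq_trans (leq_addr _ _).
by apply: sub_count => c /=; rewrite leq_eqVlt ltnS orbC.
Qed.

(** The levels up to [m] hold at most [N * m <= n / 2] elements. So at least half of the elements
    have level at least [m.+1 >= t], and each contributes at least [t ^ p]. *)
Lemma sum_powR_lower (T : eqType) (s : seq T) (h : T -> nat) N (p : R) :
  0 <= p -> (0 < N)%N ->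
  (forall k, count (fun c => h c == k) s <= N)%N ->
  (forall c, c \in s -> 0 < h c)%N ->
  ((size s)%:R / (2 * N)%:R) `^ (1 + p) <= \sum_(c <- s) (h c)%:R `^ p.
Proof.
move=> p0 N0 hN h0; set n := size s; set m := (n %/ (2 * N))%N.
have N2 : (0 < 2 * N)%N by rewrite muln_gt0.
have N2R : 0 < (2 * N)%:R :> R by rewrite ltr0n.
set t := n%:R / _; have t0 : 0 <= t by rewrite divr_ge0.
have cm : (n <= 2 * count (fun c => m < h c)%N s)%N.
  have := count_le_levels m hN h0.
  have := count_predC (fun c => h c <= m)%N s.
  rewrite (_ : count (predC _) s = count (fun c => m < h c)%N s); last first.
    by apply: eq_count => c /=; rewrite ltnNge.
  have := leq_trunc_div n (2 * N); rewrite -/m -/n; nia.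
have tm : t <= m.+1%:R.
  rewrite ler_pdivrMr// -natrM ler_nat; apply: ltnW.
  by rewrite -ltn_divLR.
apply: (@le_trans _ _ (t * t `^ p)).
  have [->|tn0] := eqVneq t 0; first by rewrite powR0 ?mul0r// gt_eqF// ltr_wpDr.
  by rewrite powRD ?powRr1 ?tn0 ?implybT.
rewrite (bigID (fun c => m < h c)%N) /=.
apply: (@le_trans _ _ (\sum_(c <- s | (m < h c)%N) t `^ p)); last first.
  apply: ler_wpDr; first by apply: sumr_ge0 => c _; exact: powR_ge0.
  apply: ler_sum => c mc; apply: ge0_ler_powR; rewrite ?nnegrE//.
  by apply: le_trans tm _; rewrite ler_nat.
rewrite big_const_seq iter_addr_0 -[leRHS]mulr_natl ler_wpM2r ?powR_ge0//.
rewrite ler_pdivrMr// -natrM ler_nat.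
by move: cm; nia.
Qed.

End PowerSums.

(** * The embedding of diagrams *)

Lemma sum_subset_le (R : numDomainType) (T : eqType) (s s' : seq T) (g : T -> R) :
  uniq s -> {subset s <= s'} -> (forall c, 0 <= g c) ->
  \sum_(c <- s) g c <= \sum_(c <- s') g c.
Proof.
move=> + + g0; elim: s s' => [|c s IHs] s' /=; first by rewrite big_nil sumr_ge0.
move=> /andP[cs us] ss'; have cs' : c \in s' by rewrite ss' ?mem_head.
rewrite big_cons (perm_big _ (perm_to_rem cs')) big_cons lerD2l; apply: IHs => //.
move=> d ds; have := ss' d; rewrite in_cons ds orbT => /(_ isT).
rewrite (perm_mem (perm_to_rem cs')) in_cons => /orP[/eqP dc|//].
by move: cs; rewrite -dc ds.
Qed.

(** * Transfer of sums over cells to sums over integers *)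

Section PartialEnumeration.
Variables (R : numDomainType) (T : eqType) (j : nat -> option T) (g : T -> R).

Definition injective_enumeration :=
  forall n m c, j n = Some c -> j m = Some c -> n = m.

Definition pullback n : R := if j n is Some c then g c else 0.

Lemma sum_pullback n :
  \sum_(0 <= i < n) pullback i = \sum_(c <- pmap j (iota 0 n)) g c.
Proof.
rewrite /index_iota subn0; elim: (iota 0 n) => [|i s IHs]; first by rewrite !big_nil.
by rewrite big_cons IHs /= /pullback; case: (j i) => [c|]; rewrite ?big_cons ?add0r.
Qed.

Lemma uniq_pmap_iota n : injective_enumeration -> uniq (pmap j (iota 0 n)).
Proof.
move=> j_inj; elim: (iota 0 n) (iota_uniq 0 n) => //= i s IHs /andP[si /IHs us].
case ji : (j i) => [c|] //=; rewrite us andbT mem_pmap.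
by apply: contra si => /mapP[k ks jk]; rewrite (j_inj _ _ _ ji (esym jk)).
Qed.

Lemma sum_pullback_le s n : injective_enumeration ->
  (forall c, 0 <= g c) -> (forall c, c \notin s -> g c = 0) ->
  \sum_(0 <= i < n) pullback i <= \sum_(c <- s) g c.
Proof.
move=> j_inj g0 gs; rewrite sum_pullback.
rewrite (bigID [in s]) /= [X in _ + X]big1 ?addr0//.
rewrite -big_filter; apply: sum_subset_le => //.
  by rewrite filter_uniq// uniq_pmap_iota.
by move=> c; rewrite mem_filter => /andP[].
Qed.

Lemma sum_pullback_ge s : uniq s -> (forall c, c \in s -> exists n, j n = Some c) ->
  (forall c, 0 <= g c) ->
  exists n, \sum_(c <- s) g c <= \sum_(0 <= i < n) pullback i.
Proof.
move=> us sj g0.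
have [n sn] : exists n, {subset s <= pmap j (iota 0 n)}.
  elim: (s) sj => [|c s' IHs] sj; first by exists 0%N.
  have [|n sn] := IHs; first by move=> d ds; apply: sj; rewrite in_cons ds orbT.
  have [k jk] := sj c (mem_head _ _); exists (maxn n k.+1) => d.
  rewrite in_cons mem_pmap => /orP[/eqP->|/sn].
    by rewrite -jk map_f// mem_iota add0n leq_maxr.
  rewrite mem_pmap => /mapP[i]; rewrite mem_iota => /andP[_ lt_in] ->.
  by rewrite map_f// mem_iota; lia.
by exists n; rewrite sum_pullback sum_subset_le.
Qed.

End PartialEnumeration.

Section Embedding.
Variables (R : realType) (Sigma : choiceType) (P : presentation Sigma).
Variables (w : seq Sigma) (e : R) (N : nat) (j : nat -> option (cell Sigma)).
Hypotheses (e0 : 0 < e) (e1 : e < 2^-1) (N0 : (0 < N)%N).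
Hypothesis dimN : cubes_bounded P w N.
Hypothesis j_inj : injective_enumeration j.
Local Notation state := (seq (letter Sigma)).
Implicit Types (q : state) (c d : cell Sigma).

Definition weight q c : R := (depth q c)%:R `^ e.

Lemma weight_notin t q cs c : built P w t q cs -> c \notin cells q ->
  weight q c = 0.
Proof.
move=> bt; rewrite -(depth_gt0 _ bt) lt0n negbK /weight => /eqP->.
by rewrite powR0// gt_eqF.
Qed.

Definition coordinates q : nat -> R := pullback j (weight q).

Lemma coordinatesB q q' n :
  coordinates q n - coordinates q' n =
  pullback j (fun c => weight q c - weight q' c) n.
Proof. by rewrite /coordinates /pullback; case: (j n) => //; rewrite subr0. Qed.

Lemma coordinates_sqr (g : cell Sigma -> R) n :
  pullback j g n * pullback j g n = pullback j (fun c => g c ^+ 2) n.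
Proof. by rewrite /pullback; case: (j n) => [c|]; rewrite ?mulr0// expr2. Qed.

Lemma coordinates_l2 t q cs : built P w t q cs -> coordinates q \in @sq_summable R.
Proof.
move=> bt; apply: (@sq_summable_bounded R _ (\sum_(c <- cells q) weight q c ^+ 2)).
move=> n; rewrite /series/=; under eq_bigr do rewrite coordinates_sqr.
apply: sum_pullback_le => // [c|c cq]; first exact: sqr_ge0.
by rewrite (weight_notin bt cq) expr0n.
Qed.

(** The value 0 only makes [vec] total: the coordinates of a built state are square-summable,
    finitely many of them being non-zero. *)
Definition vec q : l2 R :=
  if pselect (coordinates q \in @sq_summable R) is left qs then L2 qs else 0.

Lemma vecE t q cs : built P w t q cs -> vec q = coordinates q :> (nat -> R).
Proof.
by move=> /coordinates_l2 qs; rewrite /vec; case: pselect.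
Qed.

Lemma vecB t q cs t' q' cs' n : built P w t q cs -> built P w t' q' cs' ->
  (vec q - vec q') n * (vec q - vec q') n =
  pullback j (fun c => (weight q c - weight q' c) ^+ 2) n.
Proof.
move=> bt bt'; rewrite -coordinates_sqr -coordinatesB.
by rewrite -(vecE bt) -(vecE bt').
Qed.

(** A new cell contributes 1 to the squared distance; the old cells, at most [N] at each depth,
    contribute [N] times the sum of [decay]. *)
Definition edge_bound : R := Num.sqrt (1 + N%:R * (1 + (1 - 2 * e)^-1)).

Lemma edge_bound_ge0 : 0 <= edge_bound. Proof. exact: sqrtr_ge0. Qed.

Lemma vec_add_cell t A c B cs : built P w t (A ++ c.1 ++ B) cs ->
  is_cell P (labels c.1) c.2 -> ~~ cancels c ->
  `|vec (A ++ bot c ++ B) - vec (A ++ c.1 ++ B)| <= edge_bound.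
Proof.
move=> bt cc nc; have bt' := built_rcons bt cc nc.
set q := A ++ c.1 ++ B in bt *; set q' := A ++ bot c ++ B in bt' *.
apply: l2_norm_le edge_bound_ge0 _ => n.
under eq_bigr do rewrite (vecB _ bt' bt).
apply: (@le_trans _ _ (\sum_(d <- c :: cs) (weight q' d - weight q d) ^+ 2)).
  apply: sum_pullback_le => // [d|d dcs]; first exact: sqr_ge0.
  rewrite (weight_notin bt' (_ : d \notin _)) -?(built_cells bt')//.
  rewrite (weight_notin bt) -?(built_cells bt) ?subrr ?expr0n//.
  by apply: contra dcs; rewrite in_cons => ->; rewrite orbT.
have ccs : c \notin cs by have := built_uniq_cells bt' => /andP[].
have e_ge0 : 0 <= (1 - 2 * e)^-1.
  by rewrite invr_ge0 subr_ge0 mulrC -ler_pdivlMr// mul1r ltW.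
rewrite big_cons sqr_sqrtr; last first.
  by rewrite addr_ge0// mulr_ge0// addr_ge0.
have depthE d : depth q' d = ((d \in canc c) + depth q d)%N.
  exact: depth_built_rcons bt cc nc.
apply: lerD.
  (* The new cell goes from depth 0 to depth 1. *)
  rewrite (weight_notin bt) -?(built_cells bt)// subr0 /weight depthE canc_refl.
  have -> : depth q c = 0%N.
    by apply/eqP; rewrite -leqn0 leqNgt (depth_gt0 _ bt) -(built_cells bt).
  by rewrite powR1 expr1n.
apply: (@le_trans _ _ (\sum_(d <- cs) decay e (depth q d))).
  rewrite !big_seq; apply: ler_sum => d dcs; rewrite /weight depthE.
  by apply: sqr_increment_le => //; rewrite (depth_gt0 _ bt) -(built_cells bt).
apply: le_trans
  (@sum_levels _ _ cs (depth q) (decay e) N (size (cells q)).+1 _ _ _) _.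
- exact: decay_ge0.
- by move=> k; rewrite (permP (built_perm_cells bt)); exact: depth_level_bound bt.
- by move=> d _; rewrite ltnS; exact: depth_le.
- by rewrite ler_wpM2l// sum_decay_le.
Qed.

Lemma act_cases s f y : is_path P w (rcons s f) y ->
  exists t A c B cs, [/\ built P w t (A ++ c.1 ++ B) cs,
    is_cell P (labels c.1) c.2, ~~ cancels c &
    (acts w s = A ++ c.1 ++ B /\ acts w (rcons s f) = A ++ bot c ++ B) \/
    (acts w s = A ++ bot c ++ B /\ acts w (rcons s f) = A ++ c.1 ++ B)].
Proof.
case/is_path_rcons => ps ce _; have [t [cs [bt _]]] := reach ps.
have := labels_acts ps; rewrite /acts foldl_rcons -/(acts w s).
move=> /labels_catP[A [U [B [qE]]]]; rewrite {}qE in bt *.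
case: f => a u v b /= in ce ps * => eA eU eB; subst a u b.
rewrite (act_cell_edge A (U, v) B) /flip.
case: ifPn => [/cancelsP/= | nc]; last first.
  by exists t, A, (U, v), B, cs; split=> //; left.
set c := (_, _); rewrite -[dipole_top U]/(c.1) => -[eU eV].
have cc : is_cell P (labels c.1) c.2 by rewrite eV; apply: is_cellC.
rewrite eU in bt; have [t' [cs' [bt' ccs _ _]]] := built_extract_bot cc bt.
have [_ nc] := built_cell bt ccs.
by exists t', A, c, B, cs'; split=> //; right; rewrite -eU.
Qed.

Lemma vec_lipschitz s p y : is_path P w (s ++ p) y ->
  `|vec (acts w (s ++ p)) - vec (acts w s)| <= edge_bound * (size p)%:R.
Proof.
elim/last_ind: p y => [|p f IHp] y; first by rewrite cats0 subrr normr0 mulr0.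
rewrite -rcons_cat => pspf; have /is_path_rcons[psp _ _] := pspf.
rewrite size_rcons -natr1 mulrDr mulr1 [leRHS]addrC.
rewrite -[X in X - _](subrK (vec (acts w (s ++ p)))) -addrA.
apply: le_trans (ler_normD _ _) _; apply: lerD (IHp _ psp).
have [t [A [c [B [cs [bt cc nc h]]]]]] := act_cases pspf.
case: h => -[-> ->]; first exact: vec_add_cell bt cc nc.
by rewrite distrC; exact: vec_add_cell bt cc nc.
Qed.

(** Keep only the coordinates at cells proper to the first diagram. The second vector vanishes
    there, and the squares are powers [2 * e] of depths. *)
Lemma vec_lower1 t1 q1 cs1 t2 q2 cs2 :
  built P w t1 q1 cs1 -> built P w t2 q2 cs2 ->
  (forall c, c \in cells q1 -> exists n, j n = Some c) ->
  ((count (fun c => c \notin cs2) cs1)%:R / (2 * N)%:R) `^ (1 + 2 * e) <=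
  `|vec q1 - vec q2| ^+ 2.
Proof.
move=> bt1 bt2 jq; rewrite -size_filter; set s := [seq c <- cs1 | c \notin cs2].
have us : uniq s by rewrite filter_uniq// (built_uniq_cells bt1).
have sq c : c \in s -> c \in cells q1 /\ c \notin cells q2.
  by rewrite mem_filter (built_cells bt1) (built_cells bt2) => /andP[].
apply: (@le_trans _ _ (\sum_(c <- s) (depth q1 c)%:R `^ (2 * e))).
  apply: sum_powR_lower => //; first by rewrite mulr_ge0// ltW.
    move=> k; apply: leq_trans (depth_level_bound k dimN bt1).
    rewrite -(permP (built_perm_cells bt1)) /s count_filter.
    by apply: sub_count => c /andP[].
  by move=> c /sq[]; rewrite (depth_gt0 _ bt1).
have [|c|n] := @sum_pullback_ge R _ j
    (fun c => (weight q1 c - weight q2 c) ^+ 2) s us.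
- by move=> c /sq[] /jq.
- exact: sqr_ge0.
- move=> le_n; rewrite -l2_sqr_norm.
  apply: le_trans (sum_sq_le_l2inner (vec q1 - vec q2) n).
  under [leRHS]eq_bigr do rewrite (vecB _ bt1 bt2).
  apply: le_trans le_n; rewrite le_eqVlt; apply/orP; left; apply/eqP.
  rewrite !big_seq; apply: eq_bigr => c /sq[cq1 cq2].
  rewrite (weight_notin bt2 cq2) subr0 /weight -powR_mulrn ?powR_ge0// -powRrM.
  by rewrite mulrC.
Qed.

Lemma vec_lower t1 q1 cs1 t2 q2 cs2 n :
  built P w t1 q1 cs1 -> built P w t2 q2 cs2 ->
  (forall c, c \in cells q1 -> exists n, j n = Some c) ->
  (forall c, c \in cells q2 -> exists n, j n = Some c) ->
  (n <= count (fun c => c \notin cs2) cs1 + count (fun c => c \notin cs1) cs2)%N ->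
  (n%:R / (4 * N)%:R) `^ (2^-1 + e) <= `|vec q1 - vec q2|.
Proof.
(* One of the two differences has at least [n / 2] cells, which turns [2 * N] into [4 * N]; the
   square root halves the exponent. *)
have aux m x : 0 <= x -> (n <= 2 * m)%N ->
    (m%:R / (2 * N)%:R) `^ (1 + 2 * e) <= x ^+ 2 ->
    (n%:R / (4 * N)%:R) `^ (2^-1 + e) <= x.
  move=> x0 nm mx; rewrite -ler_sqr ?nnegrE ?powR_ge0//.
  rewrite -powR_mulrn ?powR_ge0// -powRrM; apply: le_trans mx.
  rewrite (_ : (2^-1 + e) * 2 = 1 + 2 * e); last by field.
  have pN k : (0 < k)%N -> 0 < (k * N)%:R :> R by rewrite ltr0n muln_gt0 N0 => ->.
  apply: ge0_ler_powR; rewrite ?nnegrE ?divr_ge0//.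
    by rewrite addr_ge0// mulr_ge0// ltW.
  rewrite ler_pdivrMr ?pN// mulrAC ler_pdivlMr ?pN// -!natrM ler_nat.
  by move: nm; nia.
move=> bt1 bt2 jq1 jq2 le_n.
have l1 := vec_lower1 bt1 bt2 jq1; have l2 := vec_lower1 bt2 bt1 jq2.
set m1 := count _ cs1 in le_n l1; set m2 := count _ cs2 in le_n l2.
have [m12|m21] := leqP m1 m2.
  have le2 : (n <= 2 * m2)%N.
    by apply: leq_trans le_n _; rewrite mul2n -addnn leq_add2r.
  by rewrite distrC; exact: aux _ _ (normr_ge0 _) le2 l2.
have le1 : (n <= 2 * m1)%N.
  by apply: leq_trans le_n _; rewrite mul2n -addnn leq_add2l ltnW.
exact: aux _ _ (normr_ge0 _) le1 l1.
Qed.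

End Embedding.

(** * Word length and diagram groups *)

Section WordLength.
Variable G : groupType.
Implicit Types (S : seq G) (g h : G).

Lemma word_length_le S g n : has_word_of_size S g n -> (word_length S g <= n)%N.
Proof.
move=> gn; rewrite /word_length; case: pselect => [ex|//].
by case: ex_minnP => m _; apply; apply/asboolP.
Qed.

Variables (S : seq G) (Sgen : generating S).

Lemma word_lengthP g : has_word_of_size S g (word_length S g).
Proof.
rewrite /word_length; case: pselect => [ex|no].
  by case: ex_minnP => m /asboolP.
case: no; have [s sS gs] := Sgen g.
by exists (size s); apply/asboolP; exists s.
Qed.

Lemma word_length_mul g h :
  (word_length S (g * h)%g <= word_length S g + word_length S h)%N.
Proof.
have [s [<- sS gs]] := word_lengthP g; have [t [<- tS ht]] := word_lengthP h.
apply: word_length_le; exists (s ++ t); split.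
- exact: size_cat.
- by move=> k; rewrite mem_cat => /orP[/sS|/tS].
- by rewrite big_cat gs ht.
Qed.

Lemma word_length_gt0 g : g <> 1%g -> (0 < word_length S g)%N.
Proof.
move=> g1; have [s [<- _ gs]] := word_lengthP g.
by case: s gs => // gs; case: g1; rewrite gs big_nil.
Qed.

Lemma bounded_on_generators (f : G -> nat) : exists K, forall g,
  g \in S \/ (g^-1)%g \in S -> (f g <= K)%N.
Proof.
exists (\sum_(s <- S) (f s + f (s^-1)%g))%N => g gS.
suff [s sS le_gs] : exists2 s, s \in S & (f g <= f s + f (s^-1)%g)%N.
  apply: leq_trans le_gs _.
  by rewrite (big_rem s sS) /= leq_addr.
case: gS => gS; first by exists g; rewrite ?leq_addr.
by exists (g^-1)%g; rewrite // invgK leq_addl.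
Qed.

Lemma word_length_subadditive (f : G -> nat) : f 1%g = 0%N ->
  (forall g h, f (g * h)%g <= f g + f h)%N ->
  exists K, forall g, (f g <= K * word_length S g)%N.
Proof.
move=> f1 fM; have [K fK] := bounded_on_generators f; exists K => g.
have [s [<- + ->]] := word_lengthP g; elim: s => [|h s IHs] sS.
  by rewrite big_nil f1.
rewrite big_cons mulnS; apply: leq_trans (fM _ _) _; apply: leq_add.
  by apply/fK/sS; rewrite mem_head.
by apply: IHs => k ks; apply: sS; rewrite in_cons ks orbT.
Qed.

(** Integers decode to words whose letters are an index in [S] and an inversion flag. *)
Lemma generated_countable : exists e : nat -> G, forall g, exists n, e n = g.
Proof.
pose letter (p : nat * bool) := (if p.2 then (nth 1 S p.1)^-1 else nth 1 S p.1)%g.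
exists (fun n => \prod_(p <- odflt [::] (unpickle n)) letter p)%g => g.
have [s sS ->] := Sgen g.
suff [r <-] : exists r, (\prod_(p <- r) letter p = \prod_(h <- s) h)%g.
  by exists (pickle r); rewrite pickleK.
elim: s sS => [|h s IHs] sS; first by exists [::]; rewrite !big_nil.
have [|r rE] := IHs; first by move=> k ks; apply: sS; rewrite in_cons ks orbT.
have [p ph] : exists p, letter p = h.
  have [hS|hS] := sS h (mem_head _ _).
    by exists (index h S, false); rewrite /letter/= nth_index.
  by exists (index (h^-1)%g S, true); rewrite /letter/= nth_index// invgK.
by exists (p :: r); rewrite !big_cons ph rE.
Qed.

End WordLength.

Lemma word_length_change (G : groupType) (S S' : seq G) :
  generating S -> generating S' ->
  exists K, forall g, (word_length S g <= K * word_length S' g)%N.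
Proof.
move=> gS gS'; apply: word_length_subadditive gS' _ _ _.
  apply/eqP; rewrite -leqn0; apply: word_length_le.
  by exists [::]; split=> //; rewrite big_nil.
exact: word_length_mul.
Qed.

(** Only the first occurrence of each value is kept. *)
Lemma exists_injective_enumeration (T : eqType) (j : nat -> option T) :
  exists2 j', injective_enumeration j' &
    forall n c, j n = Some c -> exists m, j' m = Some c.
Proof.
pose j' n := if has (fun m => j m == j n) (iota 0 n) then None else j n.
have j'P n c : j' n = Some c ->
    j n = Some c /\ forall m, (m < n)%N -> j m != Some c.
  rewrite /j'; case: ifPn => // /hasPn nj jn; split=> // m mn.
  by rewrite -jn nj// mem_iota.
exists j' => [n m c /j'P[jn nj] /j'P[jm mj]|n c jn].
  case: (ltngtP n m) => // lt; first by move: (mj n lt); rewrite jn eqxx.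
  by move: (nj m lt); rewrite jm eqxx.
have ex : exists n, j n == Some c by exists n; apply/eqP.
case: (ex_minnP ex) => m /eqP jm min_m; exists m; rewrite /j' ifN//.
apply/hasPn => k; rewrite mem_iota => /andP[_ km]; rewrite jm.
by apply: contraTN km => /min_m; rewrite -leqNgt.
Qed.

(** * Word length and cells in the diagram group *)

Section DiagramGroup.
Variables (Sigma : choiceType) (P : presentation Sigma) (w : seq Sigma).
Local Notation G := (diagram_group P w).

Lemma isotopic_equiv x y (D E : diagram P x y) : isotopic D E ->
  diagram_equiv D E /\ ncells D = ncells E.
Proof.
elim=> {D E} [D E DE|D|D E _ [? ?]|D E F _ [eDE DE] _ [eEF EF]]; split.
- by apply: rst_step; left.
- by rewrite /ncells; case: DE => s1 s2 a u1 v1 b u2 v2 c; rewrite !size_cat.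
- exact: rst_refl.
- by [].
- exact: rst_sym.
- by [].
- exact: rst_trans eDE eEF.
- by rewrite DE.
Qed.

Lemma exists_reduced x y (D : diagram P x y) :
  exists E, [/\ reduced E, diagram_equiv D E & (ncells E <= ncells D)%N].
Proof.
have [n] := ubnP (ncells D); elim: n D => // n IHn D le_n.
have [Dred|nred] := pselect (reduced D).
  by exists D; split=> //; exact: rst_refl.
have [E [F [DE EF]]] : exists E F : diagram P x y,
    isotopic D E /\ dipole_removal (val E) (val F).
  by apply: contrapT => h; apply: nred => E F DE EF; apply: h; exists E, F.
have [eDE sDE] := isotopic_equiv DE.
have lt : (ncells F < ncells D)%N.
  rewrite sDE /ncells; case: EF => s1 s2 e.
  by rewrite !size_cat /= !addnS ltnS leqnSn.
have [|E' [E'red FE' le_E']] := IHn F.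
  by apply: leq_trans lt _; rewrite -ltnS.
exists E'; split=> //; last exact: leq_trans le_E' (ltnW lt).
apply: rst_trans eDE _; apply: rst_trans _ FE'.
by apply: rst_step; right.
Qed.

Definition gpath (g : G) : seq (edge Sigma) := val (repr g).

Definition gstate (g : G) := acts w (gpath g).

Lemma gpathP g : is_path P w (gpath g) w.
Proof. exact: diagram_path. Qed.

Lemma mulgE (g h : G) : (g * h)%g = dg_mul g h. Proof. by []. Qed.

Lemma gstate_mul g h : gstate (g * h)%g = acts w (gpath g ++ gpath h).
Proof.
apply: (@acts_dequiv _ P w w); rewrite /gpath.
rewrite -[val (repr g) ++ _]/(val (dcat (repr g) (repr h))); apply/dequivP.
exact: repr_dclass.
Qed.

(** Property B bounds reduced diagrams only; reduction never increases the number of cells, so the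
    upper bound extends to all diagrams. *)
Lemma word_length_diagram (R : realType) (S : seq G) (C : R) (D : diagram P w w) :
  0 <= C ->
  (forall E : diagram P w w, reduced E ->
     (word_length S (dclass E))%:R <= C * (ncells E)%:R) ->
  (word_length S (dclass D))%:R <= C * (ncells D)%:R.
Proof.
move=> C0 SC; have [E [Ered DE le_ED]] := exists_reduced D.
have -> : dclass D = dclass E by apply/dclassP.
by apply: le_trans (SC E Ered) _; rewrite ler_wpM2l// ler_nat.
Qed.

Lemma built_dequiv s y t cs : is_path P w s y -> built P w t (acts w s) cs ->
  dequiv P w y s t.
Proof.
move=> ps bt; have [t' [cs' [bt' st']]] := reach ps.
have [|_ t't] := built_inj bt' bt.
  by move=> c; rewrite (built_cells bt') (built_cells bt).
by apply: dequiv_trans st' _; rewrite -(labels_acts ps).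
Qed.

(* The geodesic between the diagrams representing [g] and [h]. *)
Lemma quotient_diagram t1 cs1 t2 cs2 g h :
  built P w t1 (gstate g) cs1 -> built P w t2 (gstate h) cs2 ->
  exists2 D : diagram P w w, dclass D = (g^-1 * h)%g &
    (ncells D <= count (fun c => c \notin cs2) cs1 +
                 count (fun c => c \notin cs1) cs2)%N.
Proof.
move=> bt1 bt2; have [p eq_p le_p] := geodesic bt1 bt2.
have lab k : labels (gstate k) = w by exact: labels_acts (gpathP k).
rewrite lab in eq_p.
have [/is_path_catE[x pt1 pp] _] := dequiv_path eq_p.
have := is_path_inj pt1 (built_path bt1); rewrite lab => ex; subst x.
exists (mkdiagram pp) => //; apply: (mulgI g); rewrite mulVKg.
rewrite -(dclass_repr g) -(dclass_repr h) mulgE dclassM.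
apply/dclassP/dequivP.
apply: dequiv_trans (dequiv_sym (built_dequiv (gpathP h) bt2)).
apply: dequiv_trans eq_p.
by apply: dequiv_cat (dequiv_refl pp); exact: built_dequiv (gpathP g) bt1.
Qed.

(** The alphabet may be uncountable, but the group is countable and each of its elements involves
    finitely many cells. *)
Lemma exists_cells_enumeration (S : seq G) : generating S ->
  exists2 j : nat -> option (cell Sigma), injective_enumeration j &
    forall g c, c \in cells (gstate g) -> exists n, j n = Some c.
Proof.
move=> /generated_countable[u uP].
pose j n :=
  if unpickle n is Some (m, i) then onth (cells (gstate (u m))) i else None.
have [j' j'_inj jj'] := exists_injective_enumeration j.
exists j' => // g c /onthP[i cg]; have [m um] := uP g.
by apply: (jj' (pickle (m, i))); rewrite /j pickleK um.
Qed.

Lemma hilbert_exponent (R : realType) (S : seq G) (a : R) :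
  squier_finite_dimensional P w -> property_B R P w -> generating S ->
  2^-1 < a -> a < 1 -> hilbert_exponents S a.
Proof.
move=> [N0 dimN0] [S' gS' [C1 [C2 [_ C20 S'B]]]] gS a_gt a_lt.
(* The successor makes the bound positive, as the lower estimates divide by it. *)
have dimN : cubes_bounded P w N0.+1.
  by move=> c cP cw; apply: leq_trans (dimN0 c cP cw) _.
set N := N0.+1 in dimN; have Npos : (0 < N)%N by [].
pose e := a - 2^-1.
have e0 : 0 < e by rewrite subr_gt0.
have e1 : e < 2^-1 by rewrite /e; lra.
have [j j_inj jP] := exists_cells_enumeration gS.
have [K1 SS'] := word_length_change gS gS'.
(* A generator moves a state along at most [M] edges, so [f] is Lipschitz. *)
have [M SM] := bounded_on_generators S (fun g : G => size (gpath g)).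
pose f g := vec e j (gstate g); pose L : R := edge_bound e N.
have L0 : 0 <= L by exact: edge_bound_ge0.
split; first by apply/andP; split; lra.
have f_step g s : is_word S s ->
    `|f g - f (g * \prod_(h <- s) h)%g| <= L * M%:R * (size s)%:R.
  elim: s g => [|h s IHs] g sS.
    by rewrite big_nil mulg1 subrr normr0 mulr0.
  rewrite big_cons mulgA -[X in X - _](subrK (f (g * h)%g)) -addrA.
  apply: le_trans (ler_normD _ _) _.
  rewrite /= -nat1r mulrDr mulr1; apply: lerD; last first.
    by apply: IHs => k ks; apply: sS; rewrite in_cons ks orbT.
  have pgh : is_path P w (gpath g ++ gpath h) w := is_path_cat (gpathP g) (gpathP h).
  have le1 : `|f g - f (g * h)%g| <= L * (size (gpath h))%:R.
    rewrite distrC /f (gstate_mul g h).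
    exact: (vec_lipschitz e0 e1 dimN j_inj pgh).
  apply: le_trans le1 _; apply: ler_wpM2l => //.
  by rewrite ler_nat; apply/SM/sS; rewrite mem_head.
(* Lengths for [S] are at most [K1 * C2] times the number of cells, and [4 * N] comes from
   [vec_lower]; adding 1 keeps [k] positive. *)
pose k : R := (K1%:R * C2 + 1) * (4 * N)%:R.
have K1C2 : 0 <= K1%:R * C2 by rewrite mulr_ge0// ltW.
have N4 : 0 < (4 * N)%:R :> R by rewrite ltr0n.
have k0 : 0 < k by rewrite mulr_gt0// ltr_wpDl.
have a0 : 0 < a by rewrite (lt_trans _ a_gt)// invr_gt0.
have lower x y : k^-1 `^ a * (word_dist S x y)%:R `^ a <= `|f x - f y|.
  have [t1 [cs1 [bt1 _]]] := reach (gpathP x).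
  have [t2 [cs2 [bt2 _]]] := reach (gpathP y).
  have [D Dxy le_D] := quotient_diagram bt1 bt2.
  have := vec_lower e0 e1 Npos dimN j_inj bt1 bt2 (jP x) (jP y) le_D.
  rewrite [2^-1 + e]addrC subrK => /(le_trans _); apply.
  rewrite -powRM ?invr_ge0 ?(ltW k0)//.
  apply: ge0_ler_powR; rewrite ?nnegrE ?(ltW a0) ?mulr_ge0 ?invr_ge0 ?(ltW k0)//.
  rewrite mulrC ler_pdivrMr// /k [in leRHS]mulrCA divfK ?gt_eqF//.
  have S'C (E : diagram P w w) : reduced E ->
      (word_length S' (dclass E))%:R <= C2 * (ncells E)%:R.
    by move=> /S'B/andP[].
  have := word_length_diagram D (ltW C20) S'C; rewrite Dxy => le_w.
  have : (word_dist S x y)%:R <= K1%:R * (word_length S' (x^-1 * y)%g)%:R :> R.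
    by rewrite -natrM ler_nat; exact: SS'.
  have h1 : K1%:R * (word_length S' (x^-1 * y)%g)%:R <=
      K1%:R * (C2 * (ncells D)%:R).
    by rewrite ler_wpM2l.
  move=> h2; apply: le_trans h2 (le_trans h1 _).
  by rewrite mulrA ler_wpM2r// lerDl.
exists (l2_hilbert R), f, (k^-1 `^ a), (L * M%:R + 1); split.
- by rewrite powR_gt0 ?invr_gt0.
- by rewrite ltr_wpDl// mulr_ge0.
(* The lower bound separates distinct elements, whose distance is positive. *)
- move=> x y fxy; apply: contrapT => xy.
  have := lower x y; rewrite fxy subrr normr0 leNgt => /negP; apply.
  apply: mulr_gt0; first by rewrite powR_gt0 ?invr_gt0.
  apply: powR_gt0; rewrite ltr0n; apply: (word_length_gt0 gS).
  by move=> h; apply: xy; rewrite -[y](mulVKg x) h mulg1.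
- move=> x y; rewrite lower/=.
  have [s [sE sS xyE]] := word_lengthP gS (x^-1 * y)%g.
  have := f_step x s sS; rewrite -xyE mulVKg sE => /le_trans; apply.
  by rewrite ler_wpM2r// lerDl.
Qed.

End DiagramGroup.

Theorem corollary4p20 (R : realType) (Sigma : choiceType)
    (P : presentation Sigma) (w : seq Sigma) (w_neq1 : w <> [::])
    (S_findim : squier_finite_dimensional P w)
    (D_fg : finitely_generated (diagram_group P w))
    (D_B : property_B R P w) :
  forall S : seq (diagram_group P w), generating S ->
    hilbert_compression R S = 1.
Proof.
move=> S gS; have expP := hilbert_exponent S_findim D_B gS.
have ub1 : ubound (hilbert_exponents (R := R) S) 1.
  by move=> a [/andP[_]].
(* One explicit exponent makes the set non-empty and puts its supremum above [1/2]. *)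
have exp34 : hilbert_exponents S (3 / 4 : R) by apply: expP; lra.
rewrite /hilbert_compression; set X := hilbert_exponents S.
have X_sup : has_sup X by split; [exists (3 / 4) | exists 1].
apply/eqP; rewrite eq_le ge_sup//=; last by exists (3 / 4).
rewrite leNgt; apply/negP => lt1.
have le_sup a : X a -> a <= sup X by move=> Xa; exact: sup_upper_bound.
have le34 := le_sup _ exp34.
(* A supremum below 1 would be exceeded by this midpoint, which is again an exponent. *)
have : X ((sup X + 1) / 2) by apply: expP; lra.
by move=> /le_sup; lra.
Qed.
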